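(* Let $\mathcal{O}$ be an operad over $\Bbbk$ generated by one binary operation $a_1,a_2\mapsto a_1\cdot a_2$ (with no symmetry imposed), and let $\mathcal{I}\subset\mathcal{O}$ be the operadic ideal generated by the operation $\{a_1,a_2\}=a_1\cdot a_2-a_2\cdot a_1$. Suppose that the associated graded operad $\operatorname{gr}_{F_{\mathcal{I}}}\mathcal{O}$ of $\mathcal{O}$ with respect to the filtration by powers of the ideal $\mathcal{I}$ is isomorphic, as an operad, to the almost Poisson operad. Then $\mathcal{O}$ is isomorphic, as an operad, to the almost Poisson operad.
   Context: Conventions. $\Bbbk$ is a field of characteristic zero; all vector spaces are over $\Bbbk$. ''Operad'' means symmetric operad in $\Bbbk$-vector spaces; all operads $\mathcal{P}$ are assumed reduced ($\mathcal{P}(0)=0$) and connected ($\mathcal{P}(1)=\Bbbk$). Filtrations. A (decreasing) filtration of an operad $\mathcal{P}$ is a collection $F^\bullet\mathcal{P}=\{F^k\mathcal{P}\}_{k\ge0}$ of subobjects (sub-symmetric-sequences) of $\mathcal{P}$ with $F^0\mathcal{P}=\mathcal{P}$, $F^{k+1}\mathcal{P}\subset F^k\mathcal{P}$ for all $k\ge 0$, and $\gamma(\alpha;\alpha_1,\ldots,\alpha_n)\in F^{k+k_1+\cdots+k_n}\mathcal{P}$ for every structure map $\gamma$ of $\mathcal{P}$ and all $\alpha\in F^k\mathcal{P}$, $\alpha_i\in F^{k_i}\mathcal{P}$, $i=1,\ldots,n$. The associated graded operad is $\operatorname{gr}_F\mathcal{P}=\bigoplus_{k\ge0}F^k\mathcal{P}/F^{k+1}\mathcal{P}$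 with the operad structure induced from $\mathcal{P}$. Filtration by powers of an ideal. For an operadic ideal $\mathcal{I}$ of $\mathcal{P}$, the filtration $F^\bullet_{\mathcal{I}}\mathcal{P}$ of $\mathcal{P}$ by powers of $\mathcal{I}$ is the one for which $F^k_{\mathcal{I}}\mathcal{P}$ is spanned by operadic compositions in which elements of $\mathcal{I}$ are used at least $k$ times, i.e. compositions along rooted trees whose internal vertices are decorated by elements of $\mathcal{P}$ and such that for at least $k$ of the internal vertices the decoration is an element of $\mathcal{I}$. Almost Poisson operad. An almost Poisson algebra is a vector space with a commutative associative product $a_1a_2$ and an anticommutative bilinear operation $\{a_1,a_2\}$ (not required to satisfy the Jacobi identity) that is a biderivation: $\{a_1a_2,a_3\}=\{a_1,a_3\}a_2+a_1\{a_2,a_3\}$. The almost Poisson operad is the operad controlling almost Poisson algebras: it is generated by a commutative binary operation $a_1a_2$ and an anticommutative binary operation $\{a_1,a_2\}$ subject to the relations $(a_1a_2)a_3=a_1(a_2a_3)$ and $\{a_1a_2,a_3\}=\{a_1,a_3\}a_2+a_1\{a_2,a_3\}$. *)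

(* Defs.v *)
From HB Require Import structures.
From mathcomp Require Import all_boot fingroup perm all_algebra generic_quotient.
From mathcomp Require Import zify boolp.

Set Implicit Arguments.
Unset Strict Implicit.
Unset Printing Implicit Defensive.

Import GRing.Theory.
Local Open Scope ring_scope.
Local Open Scope quotient_scope.

Record subspace (k : fieldType) (V : lmodType k) := Subspace {
  subspace_set :> V -> Prop;
  subspace0 : subspace_set 0;
  subspaceZD : forall a x y,
    subspace_set x -> subspace_set y -> subspace_set (a *: x + y) }.

Section QuotientSpace.
Variables (k : fieldType) (V : lmodType k) (W : subspace V).
Implicit Types x y z : V.

Lemma subspaceD x y : W x -> W y -> W (x + y).
Proof. by move=> Wx /(subspaceZD 1 Wx); rewrite scale1r. Qed.

Lemma subspaceZ a x : W x -> W (a *: x).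
Proof. by move=> Wx; have := subspaceZD a Wx (subspace0 W); rewrite addr0. Qed.

Lemma subspaceN x : W x -> W (- x).
Proof. by move=> Wx; rewrite -scaleN1r; apply: subspaceZ. Qed.

Lemma subspaceB x y : W x -> W y -> W (x - y).
Proof. by move=> Wx Wy; apply: subspaceD => //; apply: subspaceN. Qed.

Lemma subspace_sum (I : Type) (r : seq I) (P : pred I) (F : I -> V) :
  (forall i, P i -> W (F i)) -> W (\sum_(i <- r | P i) F i).
Proof.
by move=> WF; elim/big_ind: _ => //; [apply: subspace0|apply: subspaceD].
Qed.

Definition congruent x y : bool := `[< W (x - y) >].

Lemma congruent_equiv : equiv_class_of congruent.
Proof.
split=> [x|x y|y x z]; rewrite /congruent.
- by apply/asboolP; rewrite subrr; apply: subspace0.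
- by apply/asboolP/asboolP => /subspaceN; rewrite opprB.
- move=> /asboolP xy /asboolP yz; apply/asboolP.
  by have := subspaceD xy yz; rewrite addrA subrK.
Qed.

Canonical congruent_eqv := EquivRelPack congruent_equiv.

Definition quotient := {eq_quot congruent}.
HB.instance Definition _ : EqQuotient V congruent quotient :=
  EqQuotient.on quotient.
HB.instance Definition _ := Choice.on quotient.

Lemma quotient_eq x y : W (x - y) <-> \pi_quotient x = \pi_quotient y.
Proof.
split=> [xy|]; first by apply/eqquotP/asboolP.
by move/eqquotP/asboolP.
Qed.

Lemma quotient_repr x : W (x - repr (\pi_quotient x)).
Proof. by apply/quotient_eq; rewrite reprK. Qed.

Lemma quotient_ind (P : quotient -> Prop) : (forall x, P (\pi_quotient x)) -> forall q, P q.
Proof. by move=> piP q; rewrite -[q]reprK. Qed.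

Let qadd (p q : quotient) : quotient := \pi_quotient (repr p + repr q).
Let qscale a (q : quotient) : quotient := \pi_quotient (a *: repr q).

Let qaddE x y : qadd (\pi_quotient x) (\pi_quotient y) = \pi_quotient (x + y).
Proof.
apply/quotient_eq; rewrite -opprB; apply: subspaceN.
by rewrite opprD addrACA; apply: subspaceD; apply: quotient_repr.
Qed.

Let qscaleE a x : qscale a (\pi_quotient x) = \pi_quotient (a *: x).
Proof.
apply/quotient_eq; rewrite -opprB; apply: subspaceN.
by rewrite -scalerBr; apply: subspaceZ; apply: quotient_repr.
Qed.

Let qaddA : associative qadd.
Proof.
elim/quotient_ind=> x; elim/quotient_ind=> y; elim/quotient_ind=> z.
by rewrite !qaddE addrA.
Qed.
Let qaddC : commutative qadd.
Proof.
by elim/quotient_ind=> x; elim/quotient_ind=> y; rewrite !qaddE addrC.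
Qed.
Let qadd0 : left_id (\pi_quotient 0) qadd.
Proof. by elim/quotient_ind=> x; rewrite !qaddE add0r. Qed.
Let qaddN : left_inverse (\pi_quotient 0) (qscale (-1)) qadd.
Proof. by elim/quotient_ind=> x; rewrite qscaleE qaddE scaleN1r addNr. Qed.

HB.instance Definition _ := GRing.isZmodule.Build quotient qaddA qaddC qadd0 qaddN.

Let qaddRE x y : \pi_quotient x + \pi_quotient y = \pi_quotient (x + y).
Proof. exact: qaddE. Qed.

Let qscaleA a b q : qscale a (qscale b q) = qscale (a * b) q.
Proof. by elim/quotient_ind: q => x; rewrite !qscaleE scalerA. Qed.
Let qscale1 : left_id 1 qscale.
Proof. by elim/quotient_ind=> x; rewrite !qscaleE scale1r. Qed.
Let qscaleDr : right_distributive qscale +%R.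
Proof.
move=> a; elim/quotient_ind=> x; elim/quotient_ind=> y.
by rewrite qaddRE !qscaleE qaddRE scalerDr.
Qed.
Let qscaleDl q : {morph qscale^~ q : a b / a + b}.
Proof.
by elim/quotient_ind: q => x a b; rewrite !qscaleE qaddRE scalerDl.
Qed.

HB.instance Definition _ :=
  GRing.Zmodule_isLmodule.Build k quotient qscaleA qscale1 qscaleDr qscaleDl.

Lemma quotient_pi_is_linear : linear (\pi_quotient : V -> quotient).
Proof. by move=> a x y; rewrite -qaddE -qscaleE. Qed.

HB.instance Definition _ := GRing.isLinear.Build k V quotient _
  (\pi_quotient : V -> quotient) quotient_pi_is_linear.

End QuotientSpace.

(** Inputs are numbered from 0.  When an operation with [m] inputs is plugged
    into slot [i], the slot [j != i] becomes input [outer_input i m j] of the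
    composite, and input [j] of the plugged operation becomes input [i + j]. *)
Definition outer_input (i m j : nat) : nat :=
  if (j < i)%N then j else (j + m).-1.

(** The permutation of the inputs of a composite induced by a permutation [s] of
    the outer inputs and a permutation [t] of the inner ones; these conditions
    prescribe [u] on every input. *)
Definition block_perm l m n (i : 'I_l) (s : 'S_l) (t : 'S_m) (u : 'S_n) : Prop :=
  (forall (j : 'I_l) (h : 'I_n), j != i ->
     h = outer_input i m j :> nat -> u h = outer_input (s i) m (s j) :> nat) /\
  (forall (j : 'I_m) (h : 'I_n),
     h = i + j :> nat -> u h = s i + t j :> nat)%N.

(** Operads are given by partial compositions: [comp e x i y] plugs [y] into slot
    [i] of [x].  As operads have a unit, this is the same as giving the total
    compositions [gamma (x; y_1, ..., y_n)], which plug [y_1], ..., [y_n] into the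
    slots of [x] one after the other; suboperads, ideals and filtrations with the
    unit in degree 0 are the same for partial and for total compositions.  The
    equation [e] names the arity of the result, so that the axioms need no transport
    along equalities of arities.
    [act s x] is [x] with its input [j] renamed [s j]; as [s * t] is "[s], then
    [t]" for mathcomp permutations, this is a right action. *)
Record operad (k : fieldType) := Operad {
  operad_space :> nat -> lmodType k;
  act : forall n, 'S_n -> operad_space n -> operad_space n;
  oid : operad_space 1%N;
  comp : forall l m n, (l + m = n.+1)%N ->
    operad_space l -> 'I_l -> operad_space m -> operad_space n;
  act_linear : forall n (s : 'S_n), linear (act s);
  act1 : forall n (x : operad_space n), act 1%g x = x;
  actM : forall n (s t : 'S_n) (x : operad_space n),
    act (s * t)%g x = act t (act s x);
  comp_linearl : forall l m n (e : (l + m = n.+1)%N) (i : 'I_l)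
    (y : operad_space m), linear (fun x => comp e x i y);
  comp_linearr : forall l m n (e : (l + m = n.+1)%N) (i : 'I_l)
    (x : operad_space l), linear (comp e x i);
  comp_idl : forall n (e : (1 + n = n.+1)%N) (x : operad_space n),
    comp e oid ord0 x = x;
  comp_idr : forall n (e : (n + 1 = n.+1)%N) (x : operad_space n) (i : 'I_n),
    comp e x i oid = x;
  comp_seq : forall l m n p q r (e1 : (l + m = p.+1)%N) (e2 : (p + n = q.+1)%N)
    (e3 : (m + n = r.+1)%N) (e4 : (l + r = q.+1)%N)
    (x : operad_space l) (y : operad_space m) (z : operad_space n)
    (i : 'I_l) (j : 'I_m) (h : 'I_p), h = (i + j)%N :> nat ->
    comp e2 (comp e1 x i y) h z = comp e4 x i (comp e3 y j z);
  comp_par : forall l m n p q r (e1 : (l + m = p.+1)%N) (e2 : (p + n = q.+1)%N)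
    (e3 : (l + n = r.+1)%N) (e4 : (r + m = q.+1)%N)
    (x : operad_space l) (y : operad_space m) (z : operad_space n)
    (i j : 'I_l) (h : 'I_p) (g : 'I_r), (i < j)%N ->
    h = outer_input i m j :> nat -> g = i :> nat ->
    comp e2 (comp e1 x i y) h z = comp e4 (comp e3 x j z) g y;
  comp_act : forall l m n (e : (l + m = n.+1)%N) (x : operad_space l)
    (y : operad_space m) (i : 'I_l) (s : 'S_l) (t : 'S_m) (u : 'S_n),
    block_perm i s t u ->
    comp e (act s x) (s i) (act t y) = act u (comp e x i y) }.

Arguments act {k o n}.
Arguments oid {k o}.
Arguments comp {k o l m n}.

Section OperadTheory.
Variables (k : fieldType) (P : operad k).

HB.instance Definition _ n (s : 'S_n) :=
  GRing.isLinear.Build k (P n) (P n) _ (act s) (act_linear s).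

Section Comp.
Variables (l m n : nat) (e : (l + m = n.+1)%N) (i : 'I_l).
Implicit Types (x : P l) (y : P m).

HB.instance Definition _ x :=
  GRing.isLinear.Build k (P m) (P n) _ (comp e x i) (comp_linearr e i x).

Let compl y := fun x => comp e x i y.
HB.instance Definition _ y :=
  GRing.isLinear.Build k (P l) (P n) _ (compl y) (comp_linearl e i y).

Lemma comp0l y : comp e 0 i y = 0 :> P n.
Proof. exact: (linear0 (compl y)). Qed.
Lemma comp0r x : comp e x i 0 = 0 :> P n.
Proof. exact: linear0. Qed.
Lemma compBl x1 x2 y : comp e (x1 - x2) i y = comp e x1 i y - comp e x2 i y :> P n.
Proof. exact: (linearB (compl y)). Qed.
Lemma compBr x y1 y2 : comp e x i (y1 - y2) = comp e x i y1 - comp e x i y2 :> P n.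
Proof. exact: linearB. Qed.
Lemma comp_suml (I : Type) (r : seq I) (Q : pred I) (F : I -> P l) y :
  comp e (\sum_(a <- r | Q a) F a) i y = \sum_(a <- r | Q a) comp e (F a) i y :> P n.
Proof. exact: (linear_sum (compl y)). Qed.
Lemma comp_sumr (I : Type) (r : seq I) (Q : pred I) x (F : I -> P m) :
  comp e x i (\sum_(a <- r | Q a) F a) = \sum_(a <- r | Q a) comp e x i (F a) :> P n.
Proof. exact: linear_sum. Qed.

End Comp.
End OperadTheory.

Definition reduced (k : fieldType) (P : operad k) : Prop :=
  forall x : P 0%N, x = 0.

Definition connected (k : fieldType) (P : operad k) : Prop :=
  (oid : P 1%N) <> 0 /\ forall x : P 1%N, exists c : k, x = c *: oid.

Record operad_iso (k : fieldType) (P Q : operad k) := OperadIso {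
  iso_fun :> forall n, P n -> Q n;
  iso_bij : forall n, bijective (@iso_fun n);
  iso_linear : forall n, linear (@iso_fun n);
  iso_act : forall n (s : 'S_n) (x : P n), iso_fun (act s x) = act s (iso_fun x);
  iso_id : iso_fun oid = oid;
  iso_comp : forall l m n (e : (l + m = n.+1)%N) (x : P l) (i : 'I_l) (y : P m),
    iso_fun (comp e x i y) = comp e (iso_fun x) i (iso_fun y) }.

Definition isomorphic (k : fieldType) (P Q : operad k) : Prop :=
  inhabited (operad_iso P Q).

Record subseq (k : fieldType) (P : operad k) := Subseq {
  subseq_space :> forall n, subspace (P n);
  subseq_act : forall n (s : 'S_n) (x : P n),
    subseq_space n x -> subseq_space n (act s x) }.

Record suboperad (k : fieldType) (P : operad k) := Suboperad {
  suboperad_subseq :> subseq P;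
  suboperad_id : suboperad_subseq 1%N oid;
  suboperad_comp : forall l m n (e : (l + m = n.+1)%N) (x : P l) (i : 'I_l) (y : P m),
    suboperad_subseq l x -> suboperad_subseq m y -> suboperad_subseq n (comp e x i y) }.

Definition generated_by (k : fieldType) (P : operad k) (n : nat) (mu : P n) : Prop :=
  forall S : suboperad P, S n mu -> forall m (x : P m), S m x.

Record ideal (k : fieldType) (P : operad k) := Ideal {
  ideal_subseq :> subseq P;
  ideal_compl : forall l m n (e : (l + m = n.+1)%N) (x : P l) (i : 'I_l) (y : P m),
    ideal_subseq l x -> ideal_subseq n (comp e x i y);
  ideal_compr : forall l m n (e : (l + m = n.+1)%N) (x : P l) (i : 'I_l) (y : P m),
    ideal_subseq m y -> ideal_subseq n (comp e x i y) }.

Section GeneratedIdeal.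
Variables (k : fieldType) (P : operad k) (S : forall n, P n -> Prop).

Definition ideal_gen_set n (x : P n) : Prop :=
  forall J : ideal P, (forall m (y : P m), S y -> J m y) -> J n x.

Lemma ideal_gen_set0 n : ideal_gen_set (0 : P n).
Proof. by move=> J _; apply: subspace0. Qed.

Lemma ideal_gen_setZD n a (x y : P n) :
  ideal_gen_set x -> ideal_gen_set y -> ideal_gen_set (a *: x + y).
Proof. by move=> Sx Sy J SJ; apply: subspaceZD; [apply: Sx|apply: Sy]. Qed.

Definition ideal_gen_space n : subspace (P n) :=
  Subspace (@ideal_gen_set0 n) (@ideal_gen_setZD n).

Lemma ideal_gen_act n (s : 'S_n) (x : P n) :
  ideal_gen_space n x -> ideal_gen_space n (act s x).
Proof. by move=> Sx J SJ; apply: subseq_act; apply: Sx. Qed.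

Definition ideal_gen_subseq : subseq P := Subseq ideal_gen_act.

Lemma ideal_gen_compl l m n (e : (l + m = n.+1)%N) (x : P l) (i : 'I_l) (y : P m) :
  ideal_gen_subseq l x -> ideal_gen_subseq n (comp e x i y).
Proof. by move=> Sx J SJ; apply: ideal_compl; apply: Sx. Qed.

Lemma ideal_gen_compr l m n (e : (l + m = n.+1)%N) (x : P l) (i : 'I_l) (y : P m) :
  ideal_gen_subseq m y -> ideal_gen_subseq n (comp e x i y).
Proof. by move=> Sy J SJ; apply: ideal_compr; apply: Sy. Qed.

Definition ideal_gen : ideal P := Ideal ideal_gen_compl ideal_gen_compr.

End GeneratedIdeal.

Variant singleton (k : fieldType) (P : operad k) (n : nat) (x : P n) :
  forall m, P m -> Prop := Singleton : singleton x x.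

Definition ideal_gen1 (k : fieldType) (P : operad k) (n : nat) (x : P n) : ideal P :=
  ideal_gen (singleton x).

Section QuotientOperad.
Variables (k : fieldType) (P : operad k) (I : ideal P).

Let Q n : lmodType k := quotient (I n).
Definition operad_quotient_pi n (x : P n) : Q n := \pi_(quotient (I n)) x.

Definition operad_quotient_act n (s : 'S_n) (x : Q n) : Q n := operad_quotient_pi (act s (repr x)).
Definition operad_quotient_comp l m n (e : (l + m = n.+1)%N) (x : Q l) (i : 'I_l) (y : Q m) : Q n :=
  operad_quotient_pi (comp e (repr x) i (repr y)).

Lemma operad_quotient_actE n (s : 'S_n) (x : P n) : operad_quotient_act s (operad_quotient_pi x) = operad_quotient_pi (act s x).
Proof.
apply/esym/quotient_eq; rewrite -linearB /=; apply: subseq_act.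
exact: quotient_repr.
Qed.

Lemma operad_quotient_compE l m n (e : (l + m = n.+1)%N) (x : P l) (i : 'I_l) (y : P m) :
  operad_quotient_comp e (operad_quotient_pi x) i (operad_quotient_pi y) = operad_quotient_pi (comp e x i y).
Proof.
apply/esym/quotient_eq.
rewrite -(subrK (comp e x i (repr (operad_quotient_pi y))) (comp e x i y)) -addrA.
apply: subspaceD.
  by rewrite -compBr; apply: ideal_compr; apply: quotient_repr.
by rewrite -compBl; apply: ideal_compl; apply: quotient_repr.
Qed.

Lemma operad_quotient_piZD n a (x y : P n) : a *: operad_quotient_pi x + operad_quotient_pi y = operad_quotient_pi (a *: x + y).
Proof. by rewrite /operad_quotient_pi linearP. Qed.

Lemma operad_quotient_ind n (K : Q n -> Prop) : (forall x, K (operad_quotient_pi x)) -> forall q, K q.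
Proof. exact: quotient_ind. Qed.

Definition quotient_operad : operad k.
Proof.
refine (@Operad k Q operad_quotient_act (operad_quotient_pi oid) operad_quotient_comp _ _ _ _ _ _ _ _ _ _).
- move=> n s a; elim/operad_quotient_ind=> x; elim/operad_quotient_ind=> y.
  by rewrite operad_quotient_piZD !operad_quotient_actE operad_quotient_piZD linearP.
- by move=> n; elim/operad_quotient_ind=> x; rewrite operad_quotient_actE act1.
- by move=> n s t; elim/operad_quotient_ind=> x; rewrite !operad_quotient_actE actM.
- move=> l m n e i; elim/operad_quotient_ind=> y a; elim/operad_quotient_ind=> x1; elim/operad_quotient_ind=> x2.
  by rewrite operad_quotient_piZD !operad_quotient_compE operad_quotient_piZD comp_linearl.
- move=> l m n e i; elim/operad_quotient_ind=> x a; elim/operad_quotient_ind=> y1; elim/operad_quotient_ind=> y2.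
  by rewrite operad_quotient_piZD !operad_quotient_compE operad_quotient_piZD comp_linearr.
- by move=> n e; elim/operad_quotient_ind=> x; rewrite operad_quotient_compE comp_idl.
- by move=> n e; elim/operad_quotient_ind=> x i; rewrite operad_quotient_compE comp_idr.
- move=> l m n p q r e1 e2 e3 e4.
  elim/operad_quotient_ind=> x; elim/operad_quotient_ind=> y; elim/operad_quotient_ind=> z i j h hE.
  by rewrite !operad_quotient_compE (comp_seq e1 e2 e3 e4 _ _ _ hE).
- move=> l m n p q r e1 e2 e3 e4.
  elim/operad_quotient_ind=> x; elim/operad_quotient_ind=> y; elim/operad_quotient_ind=> z i j h g ij hE gE.
  by rewrite !operad_quotient_compE (comp_par e1 e2 e3 e4 _ _ _ ij hE gE).
- move=> l m n e; elim/operad_quotient_ind=> x; elim/operad_quotient_ind=> y i s t u ustP.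
  by rewrite [in RHS]operad_quotient_compE !operad_quotient_actE operad_quotient_compE (comp_act e _ _ ustP).
Defined.

End QuotientOperad.

Record filtration (k : fieldType) (P : operad k) := Filtration {
  filt :> nat -> subseq P;
  filt0 : forall n (x : P n), filt 0%N n x;
  filtS : forall a n (x : P n), filt a.+1 n x -> filt a n x;
  filt_comp : forall a b l m n (e : (l + m = n.+1)%N)
    (x : P l) (i : 'I_l) (y : P m),
    filt a l x -> filt b m y -> filt (a + b) n (comp e x i y) }.

Lemma antidiagonal_assoc (V : zmodType) (f : nat -> nat -> nat -> V) (t : nat) :
  \sum_(p < t.+1) \sum_(q < p.+1) f q (p - q)%N (t - p)%N =
  \sum_(q < t.+1) \sum_(r < (t - q).+1) f q r (t - q - r)%N.
Proof.
transitivity (\sum_(0 <= p < t.+1) \sum_(0 <= q < t.+1 | (q <= p)%N)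
    f q (p - q)%N (t - p)%N).
  rewrite big_mkord; apply: eq_bigr => p _.
  rewrite -(big_mkord predT (fun q => f q (p - q)%N (t - p)%N)).
  rewrite (big_nat_widen _ _ t.+1) ?ltn_ord //.
rewrite (exchange_big_dep_nat predT) //= big_mkord; apply: eq_bigr => q _.
rewrite -(big_mkord predT (fun r => f q r (t - q - r)%N)).
transitivity (\sum_(q <= p < t.+1) f q (p - q)%N (t - p)%N).
  by rewrite (big_nat_widenl q 0) //; apply: eq_bigl => p; rewrite andbT.
rewrite -{1}[X in \sum_(X <= _ < _) _]add0n big_addn subSn -1?ltnS ?ltn_ord //.
by apply: eq_bigr => r _; rewrite addnK addnC subnDA.
Qed.

Lemma antidiagonal_rev (V : zmodType) (f : nat -> nat -> V) (t : nat) :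
  \sum_(p < t.+1) f p (t - p)%N = \sum_(p < t.+1) f (t - p)%N p.
Proof.
rewrite (reindex_inj rev_ord_inj); apply: eq_bigr => p _ /=.
by rewrite subSS subKn // -ltnS.
Qed.

Section AssociatedGraded.
Variables (k : fieldType) (P : operad k) (F : filtration P).

(** [F^a P(n) / F^(a+1) P(n)] is seen inside [P(n) / F^(a+1) P(n)], as the image
    of [F^a P(n)]; an element of the direct sum is the family of its components. *)
Record graded n := Graded {
  component : forall a, quotient (F a.+1 n);
  component_filt : forall a, exists2 x : P n, F a n x & component a = \pi x;
  component_finite : exists N, forall a, (N <= a)%N -> component a = 0 }.

HB.instance Definition _ n := gen_eqMixin (graded n).
HB.instance Definition _ n := gen_choiceMixin (graded n).

Lemma graded_eq n (x y : graded n) :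
  (forall a, component x a = component y a) -> x = y.
Proof.
case: x y => x xF xN [y yF yN] /= xy.
have {}xy : x = y by apply: functional_extensionality_dep.
by case: _ / xy in yF yN *; congr Graded; apply: Prop_irrelevance.
Qed.

Section Space.
Variable n : nat.
Implicit Types (x y : graded n) (c : k).

Let add_filt x y a :
  exists2 z : P n, F a n z & component x a + component y a = \pi z.
Proof.
have [[u Fu ->] [v Fv ->]] := (component_filt x a, component_filt y a).
by exists (u + v); [apply: subspaceD|rewrite linearD].
Qed.
Let add_finite x y : exists N, forall a, (N <= a)%N ->
  component x a + component y a = 0.
Proof.
have [[N xN] [M yM]] := (component_finite x, component_finite y).
exists (maxn N M) => a; rewrite geq_max => /andP[Na Ma].
by rewrite xN // yM // addr0.
Qed.
Let scale_filt c x a : exists2 z : P n, F a n z & c *: component x a = \pi z.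
Proof.
have [u Fu ->] := component_filt x a.
by exists (c *: u); [apply: subspaceZ|rewrite linearZ].
Qed.
Let scale_finite c x : exists N, forall a, (N <= a)%N -> c *: component x a = 0.
Proof.
by have [N xN] := component_finite x; exists N => a /xN ->; rewrite scaler0.
Qed.
Let zero_filt a : exists2 z : P n, F a n z & 0 = \pi_(quotient (F a.+1 n)) z.
Proof. by exists 0; [apply: subspace0|rewrite linear0]. Qed.

Let gzero := Graded zero_filt (ex_intro _ 0%N (fun _ _ => erefl)).
Let gadd x y := Graded (add_filt x y) (add_finite x y).
Let gscale c x := Graded (scale_filt c x) (scale_finite c x).

Let gaddA : associative gadd.
Proof. by move=> x y z; apply: graded_eq => a /=; rewrite addrA. Qed.
Let gaddC : commutative gadd.
Proof. by move=> x y; apply: graded_eq => a /=; rewrite addrC. Qed.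
Let gadd0 : left_id gzero gadd.
Proof. by move=> x; apply: graded_eq => a /=; rewrite add0r. Qed.
Let gaddN : left_inverse gzero (gscale (-1)) gadd.
Proof. by move=> x; apply: graded_eq => a /=; rewrite scaleN1r addNr. Qed.

HB.instance Definition _ := GRing.isZmodule.Build (graded n) gaddA gaddC gadd0 gaddN.

Let gscaleA c d x : gscale c (gscale d x) = gscale (c * d) x.
Proof. by apply: graded_eq => a /=; rewrite scalerA. Qed.
Let gscale1 : left_id 1 gscale.
Proof. by move=> x; apply: graded_eq => a /=; rewrite scale1r. Qed.
Let gscaleDr : right_distributive gscale +%R.
Proof. by move=> c x y; apply: graded_eq => a /=; rewrite scalerDr. Qed.
Let gscaleDl x : {morph gscale^~ x : c d / c + d}.
Proof. by move=> c d; apply: graded_eq => a /=; rewrite scalerDl. Qed.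

HB.instance Definition _ :=
  GRing.Zmodule_isLmodule.Build k (graded n) gscaleA gscale1 gscaleDr gscaleDl.

End Space.

(** [r] is a family of representatives of the components of [x]. *)
Definition lifts n (r : nat -> P n) (x : graded n) : Prop :=
  (forall a, F a n (r a)) /\ (forall a, component x a = \pi_(quotient (F a.+1 n)) (r a)).

Definition reprs n (x : graded n) (a : nat) : P n := repr (component x a).

Lemma lifts_reprs n (x : graded n) : lifts (reprs x) x.
Proof.
split=> a; last by rewrite reprK.
have [u Fu xu] := component_filt x a; rewrite /reprs xu.
rewrite -(subKr u (repr _)); apply: subspaceB => //.
by apply: filtS; apply: quotient_repr.
Qed.

Lemma repr_lifts n (r : nat -> P n) (x : graded n) a :
  lifts r x -> F a.+1 n (reprs x a - r a).
Proof. by move=> [_ xr]; apply/quotient_eq; rewrite -xr /reprs reprK. Qed.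

Lemma reprs_finite n (x : graded n) :
  exists N, forall a, (N <= a)%N -> F a.+1 n (reprs x a).
Proof.
have [N xN] := component_finite x; exists N => a /xN xa.
by rewrite -[reprs x a]subr0; apply/quotient_eq; rewrite linear0 reprK.
Qed.

Lemma lifts_eq n (r s : nat -> P n) (x y : graded n) :
  lifts r x -> lifts s y -> (forall a, F a.+1 n (r a - s a)) -> x = y.
Proof.
move=> [_ xr] [_ ys] rs; apply: graded_eq => a; rewrite xr ys.
exact/quotient_eq.
Qed.

Lemma lifts_eq1 n (r s : nat -> P n) (x y : graded n) :
  lifts r x -> lifts s y -> r =1 s -> x = y.
Proof.
by move=> xr ys rs; apply: (lifts_eq xr ys) => a; rewrite rs subrr; apply: subspace0.
Qed.

Lemma of_lift_filt n (r : nat -> P n) (rF : forall a, F a n (r a)) a :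
  exists2 x : P n, F a n x & \pi_(quotient (F a.+1 n)) (r a) = \pi x.
Proof. by exists (r a). Qed.

Lemma of_lift_finite n (r : nat -> P n)
  (rN : exists N, forall a, (N <= a)%N -> F a.+1 n (r a)) :
  exists N, forall a, (N <= a)%N -> \pi_(quotient (F a.+1 n)) (r a) = 0.
Proof.
have [N rNF] := rN; exists N => a /rNF ra.
by rewrite -(linear0 (\pi_(quotient (F a.+1 n)))); apply/quotient_eq; rewrite subr0.
Qed.

Definition of_lift n (r : nat -> P n) rF rN : graded n :=
  Graded (@of_lift_filt n r rF) (@of_lift_finite n r rN).

Lemma lifts_of n r (rF : forall a, F a n (r a)) rN : lifts r (of_lift rF rN).
Proof. by []. Qed.

Lemma lifts_linear n c (r s : nat -> P n) (x y : graded n) :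
  lifts r x -> lifts s y -> lifts (fun a => c *: r a + s a) (c *: x + y).
Proof.
move=> [Fr xr] [Fs ys]; split=> a; first exact: subspaceZD.
by rewrite [LHS]/(c *: component x a + component y a) xr ys linearP.
Qed.

(** The operations induced by those of [P], computed on representatives of the
    components; [lifts_act] and [lifts_comp] show that the choice of
    representatives does not matter. *)

Definition gr_id_rep (a : nat) : P 1%N := if a is 0%N then oid else 0.

Definition gr_act_rep n (s : 'S_n) (r : nat -> P n) (a : nat) : P n := act s (r a).

Definition gr_comp_rep l m n (e : (l + m = n.+1)%N) (r : nat -> P l) (i : 'I_l)
    (s : nat -> P m) (a : nat) : P n :=
  \sum_(b < a.+1) comp e (r b) i (s (a - b)%N).

Lemma gr_id_filt a : F a 1%N (gr_id_rep a).
Proof. by case: a => [|a]; [apply: filt0|apply: subspace0]. Qed.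

Lemma gr_id_finite : exists N, forall a, (N <= a)%N -> F a.+1 1%N (gr_id_rep a).
Proof. by exists 1%N => -[|a] // _; apply: subspace0. Qed.

Lemma gr_act_filt n (s : 'S_n) r :
  (forall a, F a n (r a)) -> forall a, F a n (gr_act_rep s r a).
Proof. by move=> Fr a; apply: subseq_act. Qed.

Lemma gr_act_finite n (s : 'S_n) (x : graded n) :
  exists N, forall a, (N <= a)%N -> F a.+1 n (gr_act_rep s (reprs x) a).
Proof.
by have [N xN] := reprs_finite x; exists N => a /xN xa; apply: subseq_act.
Qed.

Lemma gr_comp_filt l m n (e : (l + m = n.+1)%N) r (i : 'I_l) s :
  (forall a, F a l (r a)) -> (forall a, F a m (s a)) ->
  forall a, F a n (gr_comp_rep e r i s a).
Proof.
move=> Fr Fs a; apply: subspace_sum => b _.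
by rewrite -{1}(@subnKC b a) -1?ltnS //; apply: filt_comp.
Qed.

Lemma gr_comp_finite l m n (e : (l + m = n.+1)%N) (x : graded l) (i : 'I_l)
    (y : graded m) :
  exists N, forall a, (N <= a)%N -> F a.+1 n (gr_comp_rep e (reprs x) i (reprs y) a).
Proof.
have [[N xN] [M yM]] := (reprs_finite x, reprs_finite y).
exists (N + M)%N => a NMa; apply: subspace_sum => b _.
have ba : (b <= a)%N by rewrite -ltnS.
have [Nb|bN] := leqP N b.
  rewrite -{1}(subnKC ba) -addSn; apply: filt_comp; first exact: xN.
  exact: (lifts_reprs _).1.
rewrite -{1}(subnKC ba) -addnS; apply: filt_comp; first exact: (lifts_reprs _).1.
apply: yM; rewrite leq_subRL //; apply: leq_trans NMa.
by rewrite leq_add2r ltnW.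
Qed.

Definition gr_id : graded 1 := of_lift gr_id_filt gr_id_finite.

Definition gr_act n (s : 'S_n) (x : graded n) : graded n :=
  of_lift (gr_act_filt s (lifts_reprs x).1) (gr_act_finite s x).

Definition gr_comp l m n (e : (l + m = n.+1)%N) (x : graded l) (i : 'I_l) (y : graded m) :
    graded n :=
  of_lift (gr_comp_filt e i (lifts_reprs x).1 (lifts_reprs y).1)
    (gr_comp_finite e x i y).

Lemma lifts_act n (s : 'S_n) r (x : graded n) :
  lifts r x -> lifts (gr_act_rep s r) (gr_act s x).
Proof.
move=> xr; split=> a; first by apply: gr_act_filt; apply: xr.1.
apply/quotient_eq; rewrite -linearB; apply: subseq_act.
exact: repr_lifts.
Qed.

Lemma lifts_comp l m n (e : (l + m = n.+1)%N) r (x : graded l) (i : 'I_l) s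
    (y : graded m) :
  lifts r x -> lifts s y -> lifts (gr_comp_rep e r i s) (gr_comp e x i y).
Proof.
move=> xr ys; split=> a.
  by apply: gr_comp_filt; [apply: xr.1|apply: ys.1].
apply/quotient_eq; rewrite -sumrB; apply: subspace_sum => b _.
have ba : (b <= a)%N by rewrite -ltnS.
rewrite -(subrK (comp e (r b) i (reprs y (a - b)%N))
  (comp e (reprs x b) i (reprs y (a - b)%N))) -addrA.
apply: subspaceD.
  rewrite -compBl -{1}(subnKC ba) -addSn; apply: filt_comp.
    exact: repr_lifts.
  exact: (lifts_reprs _).1.
rewrite -compBr -{1}(subnKC ba) -addnS; apply: filt_comp; first exact: xr.1.
exact: repr_lifts.
Qed.

Lemma lifts_id : lifts gr_id_rep gr_id. Proof. exact: lifts_of. Qed.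

Definition gr : operad k.
Proof.
refine (@Operad k graded gr_act gr_id gr_comp _ _ _ _ _ _ _ _ _ _).
- move=> n s c x y; have [xr yr] := (lifts_reprs x, lifts_reprs y).
  apply: (lifts_eq1 (lifts_act s (lifts_linear c xr yr))
    (lifts_linear c (lifts_act s xr) (lifts_act s yr))) => a.
  exact: act_linear.
- move=> n x; apply: (lifts_eq1 (lifts_act _ (lifts_reprs x)) (lifts_reprs x)) => a.
  exact: act1.
- move=> n s t x; have xr := lifts_reprs x.
  apply: (lifts_eq1 (lifts_act _ xr) (lifts_act t (lifts_act s xr))) => a.
  exact: actM.
- move=> l m n e i y c x1 x2.
  have [yr [xr1 xr2]] := (lifts_reprs y, (lifts_reprs x1, lifts_reprs x2)).
  apply: (lifts_eq1 (lifts_comp e i (lifts_linear c xr1 xr2) yr)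
    (lifts_linear c (lifts_comp e i xr1 yr) (lifts_comp e i xr2 yr))) => a.
  rewrite /gr_comp_rep scaler_sumr -big_split; apply: eq_bigr => b _.
  exact: comp_linearl.
- move=> l m n e i x c y1 y2.
  have [xr [yr1 yr2]] := (lifts_reprs x, (lifts_reprs y1, lifts_reprs y2)).
  apply: (lifts_eq1 (lifts_comp e i xr (lifts_linear c yr1 yr2))
    (lifts_linear c (lifts_comp e i xr yr1) (lifts_comp e i xr yr2))) => a.
  rewrite /gr_comp_rep scaler_sumr -big_split; apply: eq_bigr => b _.
  exact: comp_linearr.
- move=> n e x; have xr := lifts_reprs x.
  apply: (lifts_eq1 (lifts_comp e ord0 lifts_id xr) xr) => a.
  rewrite /gr_comp_rep big_ord_recl big1 => [|b _]; last exact: comp0l.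
  by rewrite addr0 subn0 comp_idl.
- move=> n e x i; have xr := lifts_reprs x.
  apply: (lifts_eq1 (lifts_comp e i xr lifts_id) xr) => a.
  rewrite /gr_comp_rep big_ord_recr big1 => [|b _] /=.
    by rewrite add0r subnn comp_idr.
  have : (0 < a - b)%N by rewrite subn_gt0.
  by case: (a - b)%N => // c _; apply: comp0r.
- move=> l m n p q r e1 e2 e3 e4 x y z i j h hE.
  have [xr [yr zr]] := (lifts_reprs x, (lifts_reprs y, lifts_reprs z)).
  apply: (lifts_eq1 (lifts_comp e2 h (lifts_comp e1 i xr yr) zr)
    (lifts_comp e4 i xr (lifts_comp e3 j yr zr))) => a.
  rewrite /gr_comp_rep.
  under eq_bigr do rewrite comp_suml.
  under [RHS]eq_bigr do rewrite comp_sumr.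
  rewrite (antidiagonal_assoc (fun a b c => comp e2
    (comp e1 (reprs x a) i (reprs y b)) h (reprs z c))).
  apply: eq_bigr => b _; apply: eq_bigr => c _.
  exact: comp_seq.
- move=> l m n p q r e1 e2 e3 e4 x y z i j h g ij hE gE.
  have [xr [yr zr]] := (lifts_reprs x, (lifts_reprs y, lifts_reprs z)).
  apply: (lifts_eq1 (lifts_comp e2 h (lifts_comp e1 i xr yr) zr)
    (lifts_comp e4 g (lifts_comp e3 j xr zr) yr)) => a.
  rewrite /gr_comp_rep.
  under eq_bigr do rewrite comp_suml.
  under [RHS]eq_bigr do rewrite comp_suml.
  rewrite (antidiagonal_assoc (fun a b c => comp e2
    (comp e1 (reprs x a) i (reprs y b)) h (reprs z c))).
  rewrite (antidiagonal_assoc (fun a b c => comp e4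
    (comp e3 (reprs x a) j (reprs z b)) g (reprs y c))).
  apply: eq_bigr => b _.
  rewrite (antidiagonal_rev (fun c d => comp e2
    (comp e1 (reprs x b) i (reprs y c)) h (reprs z d))).
  apply: eq_bigr => c _.
  exact: comp_par.
- move=> l m n e x y i s t u ustP.
  have [xr yr] := (lifts_reprs x, lifts_reprs y).
  apply: (lifts_eq1 (lifts_comp e (s i) (lifts_act s xr) (lifts_act t yr))
    (lifts_act u (lifts_comp e i xr yr))) => a.
  rewrite /gr_comp_rep /gr_act_rep linear_sum; apply: eq_bigr => b _.
  exact: comp_act.
Defined.

End AssociatedGraded.

Section IdealPowers.
Variables (k : fieldType) (P : operad k).

Section Span.
Variables (V : lmodType k) (S : V -> Prop).

Definition span_set (x : V) : Prop :=
  forall W : subspace V, (forall y, S y -> W y) -> W x.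

Lemma span_set0 : span_set 0.
Proof. by move=> W _; apply: subspace0. Qed.

Lemma span_setZD a x y : span_set x -> span_set y -> span_set (a *: x + y).
Proof. by move=> Sx Sy W SW; apply: subspaceZD; [apply: Sx|apply: Sy]. Qed.

Definition span : subspace V := Subspace span_set0 span_setZD.

End Span.

Lemma span_linear (V V' : lmodType k) (S : V -> Prop) (S' : V' -> Prop)
    (f : V -> V') : linear f -> (forall x, S x -> span S' (f x)) ->
  forall x, span S x -> span S' (f x).
Proof.
move=> f_lin SS' x Sx.
have preim0 : span S' (f 0).
  have := f_lin (-1) 0 0; rewrite scaler0 addr0 scaleN1r addNr => ->.
  exact: subspace0.
have preimZD a y z : span S' (f y) -> span S' (f z) -> span S' (f (a *: y + z)).
  by rewrite f_lin; apply: subspaceZD.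
exact: (Sx (Subspace preim0 preimZD)).
Qed.

Variable I : ideal P.

(** [tree_composition a x]: [x] is a composition along a rooted tree with labelled
    leaves, in which [a] selected vertices are decorated by elements of [I] and
    the others by arbitrary elements of [P], possibly in [I] too; so [I]-decorated
    vertices are counted "at least". *)
Inductive tree_composition : nat -> forall n, P n -> Prop :=
| tree_trivial : tree_composition 0 oid
| tree_vertex n (x : P n) : tree_composition 0 x
| tree_ideal_vertex n (x : P n) : I n x -> tree_composition 1 x
| tree_graft a b l m n (e : (l + m = n.+1)%N) (x : P l) (i : 'I_l) (y : P m) :
    tree_composition a x -> tree_composition b y ->
    tree_composition (a + b) (comp e x i y)
| tree_relabel a n (s : 'S_n) (x : P n) :
    tree_composition a x -> tree_composition a (act s x).

Definition ideal_power_space (a n : nat) : subspace (P n) :=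
  span (fun x : P n => tree_composition a x).

Lemma ideal_power_act a n (s : 'S_n) (x : P n) :
  ideal_power_space a n x -> ideal_power_space a n (act s x).
Proof.
apply: span_linear; first exact: act_linear.
by move=> y ty W; apply; apply: tree_relabel.
Qed.

Definition ideal_power (a : nat) : subseq P := Subseq (@ideal_power_act a).

Lemma ideal_power0 n (x : P n) : ideal_power 0 n x.
Proof. by move=> W; apply; apply: tree_vertex. Qed.

Lemma tree_composition_le a b n (x : P n) :
  (b <= a)%N -> tree_composition a x -> tree_composition b x.
Proof.
move=> + xa; elim: xa b => {a n x}.
- by move=> b; rewrite leqn0 => /eqP ->; apply: tree_trivial.
- by move=> n x b; rewrite leqn0 => /eqP ->; apply: tree_vertex.
- by move=> n x Ix [|[|//]] _; [apply: tree_vertex|apply: tree_ideal_vertex].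
- move=> a a' l m n e x i y _ IHx _ IHy b ba.
  rewrite -(subnKC (geq_minl b a)); apply: tree_graft.
    by apply: IHx; apply: geq_minr.
  by apply: IHy; lia.
- by move=> a n s x _ IHx b /IHx; apply: tree_relabel.
Qed.

Lemma ideal_powerS a n (x : P n) : ideal_power a.+1 n x -> ideal_power a n x.
Proof.
move=> xa W aW; apply: xa => y ya; apply: aW.
by apply: tree_composition_le ya.
Qed.

Lemma ideal_power_comp a b l m n (e : (l + m = n.+1)%N)
    (x : P l) (i : 'I_l) (y : P m) :
  ideal_power a l x -> ideal_power b m y -> ideal_power (a + b) n (comp e x i y).
Proof.
move=> xa yb; move: x xa; apply: span_linear; first exact: comp_linearl.
move=> x xa; move: y yb; apply: span_linear; first exact: comp_linearr.
by move=> y yb W; apply; apply: tree_graft.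
Qed.

Definition ideal_filtration : filtration P :=
  Filtration ideal_power0 ideal_powerS ideal_power_comp.

End IdealPowers.

Section FreeOperad.
Variables (k : fieldType) (E : nat -> Type).

Inductive operad_term : nat -> Type :=
| term_gen n of E n : operad_term n
| term_zero n : operad_term n
| term_add n of operad_term n & operad_term n : operad_term n
| term_scale n of k & operad_term n : operad_term n
| term_id : operad_term 1
| term_act n of 'S_n & operad_term n : operad_term n
| term_comp l m n of (l + m = n.+1)%N & operad_term l & 'I_l & operad_term m :
    operad_term n.

Fixpoint term_eval (Q : operad k) (g : forall n, E n -> Q n) n
    (t : operad_term n) : Q n :=
  match t in operad_term n return Q n with
  | term_gen _ a => g _ a
  | term_zero _ => 0
  | term_add _ t u => term_eval g t + term_eval g u
  | term_scale _ c t => c *: term_eval g t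
  | term_id => oid
  | term_act _ s t => act s (term_eval g t)
  | term_comp _ _ _ e t i u => comp e (term_eval g t) i (term_eval g u)
  end.

HB.instance Definition _ n := gen_eqMixin (operad_term n).
HB.instance Definition _ n := gen_choiceMixin (operad_term n).

(** The free operad is the operad of terms, two terms being identified when they
    agree in every operad, i.e. when they are equal by the axioms of operads. *)
Definition term_equiv n (t u : operad_term n) : bool :=
  `[< forall (Q : operad k) (g : forall n, E n -> Q n),
      term_eval g t = term_eval g u >].

Lemma term_equivP n : equiv_class_of (@term_equiv n).
Proof.
split=> [t|t u|t u v]; rewrite /term_equiv.
- exact/asboolP.
- by apply/asboolP/asboolP => tu Q g; rewrite tu.
- by move=> /asboolP tu /asboolP uv; apply/asboolP => Q g; rewrite tu.
Qed.

Canonical term_equiv_rel n := EquivRelPack (@term_equivP n).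

Definition free_space n := {eq_quot (@term_equiv n)}.
HB.instance Definition _ n : EqQuotient _ (@term_equiv n) (free_space n) :=
  EqQuotient.on (free_space n).
HB.instance Definition _ n := Choice.on (free_space n).

Definition free_pi n (t : operad_term n) : free_space n := \pi_(free_space n) t.

Lemma free_pi_eq n (t u : operad_term n) :
  (forall (Q : operad k) (g : forall n, E n -> Q n),
    term_eval g t = term_eval g u) -> free_pi t = free_pi u.
Proof. by move=> tu; apply/eqquotP/asboolP. Qed.

Lemma term_eval_repr (Q : operad k) (g : forall n, E n -> Q n) n (t : operad_term n) :
  term_eval g (repr (free_pi t)) = term_eval g t.
Proof.
by have /eqquotP/asboolP -> : repr (free_pi t) = t %[mod (free_space n)]
  by rewrite reprK.
Qed.

Section Space.
Variable n : nat.
Implicit Types (x y z : free_space n) (c d : k).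

Let fzero : free_space n := free_pi (term_zero n).
Let fadd x y : free_space n := free_pi (term_add (repr x) (repr y)).
Let fscale c x : free_space n := free_pi (term_scale c (repr x)).

Let faddA : associative fadd.
Proof.
by move=> x y z; apply: free_pi_eq => Q g /=; rewrite !term_eval_repr /= addrA.
Qed.
Let faddC : commutative fadd.
Proof. by move=> x y; apply: free_pi_eq => Q g /=; rewrite addrC. Qed.
Let fadd0 : left_id fzero fadd.
Proof.
move=> x; rewrite -[RHS]reprK; apply: free_pi_eq => Q g /=.
by rewrite term_eval_repr add0r.
Qed.
Let faddN : left_inverse fzero (fscale (-1)) fadd.
Proof.
by move=> x; apply: free_pi_eq => Q g /=; rewrite term_eval_repr /= scaleN1r addNr.
Qed.

HB.instance Definition _ :=
  GRing.isZmodule.Build (free_space n) faddA faddC fadd0 faddN.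

Let fscaleA c d x : fscale c (fscale d x) = fscale (c * d) x.
Proof. by apply: free_pi_eq => Q g /=; rewrite term_eval_repr /= scalerA. Qed.
Let fscale1 : left_id 1 fscale.
Proof.
move=> x; rewrite -[RHS]reprK; apply: free_pi_eq => Q g /=.
by rewrite scale1r.
Qed.
Let fscaleDr : right_distributive fscale +%R.
Proof.
by move=> c x y; apply: free_pi_eq => Q g /=; rewrite !term_eval_repr /= scalerDr.
Qed.
Let fscaleDl x : {morph fscale^~ x : c d / c + d}.
Proof.
by move=> c d; apply: free_pi_eq => Q g /=; rewrite !term_eval_repr /= scalerDl.
Qed.

HB.instance Definition _ :=
  GRing.Zmodule_isLmodule.Build k (free_space n) fscaleA fscale1 fscaleDr fscaleDl.

Lemma free_linearE c x y :
  c *: x + y = free_pi (term_add (term_scale c (repr x)) (repr y)).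
Proof. by apply: free_pi_eq => Q g /=; rewrite term_eval_repr. Qed.

End Space.

Definition free_act n (s : 'S_n) (x : free_space n) : free_space n :=
  free_pi (term_act s (repr x)).
Definition free_comp l m n (e : (l + m = n.+1)%N) (x : free_space l) (i : 'I_l)
    (y : free_space m) : free_space n :=
  free_pi (term_comp e (repr x) i (repr y)).

Definition free_operad : operad k.
Proof.
refine (@Operad k free_space free_act (free_pi term_id) free_comp _ _ _ _ _ _ _ _ _ _).
- move=> n s c x y; rewrite !free_linearE; apply: free_pi_eq => Q g.
  by rewrite /= !term_eval_repr /= act_linear.
- move=> n x; rewrite -[RHS]reprK; apply: free_pi_eq => Q g.
  by rewrite /= act1.
- move=> n s t x; apply: free_pi_eq => Q g.
  by rewrite /= !term_eval_repr /= actM.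
- move=> l m n e i y c x1 x2; rewrite !free_linearE; apply: free_pi_eq => Q g.
  by rewrite /= !term_eval_repr /= comp_linearl.
- move=> l m n e i x c y1 y2; rewrite !free_linearE; apply: free_pi_eq => Q g.
  by rewrite /= !term_eval_repr /= comp_linearr.
- move=> n e x; rewrite -[RHS]reprK; apply: free_pi_eq => Q g.
  by rewrite /= !term_eval_repr /= comp_idl.
- move=> n e x i; rewrite -[RHS]reprK; apply: free_pi_eq => Q g.
  by rewrite /= !term_eval_repr /= comp_idr.
- move=> l m n p q r e1 e2 e3 e4 x y z i j h hE; apply: free_pi_eq => Q g.
  by rewrite /= !term_eval_repr /= (comp_seq e1 e2 e3 e4 _ _ _ hE).
- move=> l m n p q r e1 e2 e3 e4 x y z i j h g ij hE gE.
  apply: free_pi_eq => Q f.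
  by rewrite /= !term_eval_repr /= (comp_par e1 e2 e3 e4 _ _ _ ij hE gE).
- move=> l m n e x y i s t u ustP; apply: free_pi_eq => Q g.
  by rewrite /= !term_eval_repr /= (comp_act e _ _ ustP).
Defined.

Definition free_gen n (a : E n) : free_operad n := free_pi (term_gen a).

End FreeOperad.

Arguments free_gen k {E n}.

Definition presented_operad (k : fieldType) (E : nat -> Type)
    (R : forall n, free_operad k E n -> Prop) : operad k :=
  quotient_operad (ideal_gen R).

Variant ap_generator : nat -> Type :=
| ap_product : ap_generator 2
| ap_bracket : ap_generator 2.

Definition swap12 : 'S_2 := tperm ord0 ord_max.
Definition swap23 : 'S_3 := tperm (@Ordinal 3 1 isT) (@Ordinal 3 2 isT).

Section AlmostPoisson.
Variable k : fieldType.

Local Notation F := (free_operad k ap_generator).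
Local Notation mul := (free_gen k ap_product : F 2%N).
Local Notation br := (free_gen k ap_bracket : F 2%N).
(** For binary [f] and [g], [f o1 g] is [f (g (a1, a2), a3)] and [f o2 g] is
    [f (a1, g (a2, a3))]. *)
Local Notation "f 'o1' g" := (comp (erefl 4%N : 2 + 2 = 4)%N f ord0 g : F 3%N)
  (at level 40).
Local Notation "f 'o2' g" := (comp (erefl 4%N : 2 + 2 = 4)%N f ord_max g : F 3%N)
  (at level 40).

(** The elements set to zero: commutativity, anticommutativity, associativity
    [(a1 a2) a3 - a1 (a2 a3)], and the Leibniz rule
    [{a1 a2, a3} - ({a1, a3} a2 + a1 {a2, a3})]. *)
Variant ap_relation : forall n, F n -> Prop :=
| ap_comm : ap_relation (act swap12 mul - mul)
| ap_anticomm : ap_relation (act swap12 br + br)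
| ap_assoc : ap_relation (mul o1 mul - mul o2 mul)
| ap_leibniz :
    ap_relation (br o1 mul - (act swap23 (mul o1 br) + mul o2 br)).

Definition almost_poisson : operad k := presented_operad ap_relation.

End AlmostPoisson.

(* Main.v *)
From HB Require Import structures.
From mathcomp Require Import all_boot fingroup perm all_algebra generic_quotient.
From mathcomp Require Import zify ring boolp.
From mathcomp Require Import mpoly.
Require Import Defs.

(** Polarize the generator: [f = mu + mu^op] is commutative, [g = mu - mu^op] is
    anticommutative, and together they generate [P].  Since the ideal is generated
    by [g], the space [F^a P(n)] is spanned by the composites of copies of [f] and
    [g] in which [g] occurs at least [a] times ([power_degree_ge]); a composite of
    arity [n] has [n - 1] factors, so [F^a P(n) = 0] for [a >= n] ([power_eq0]).

    The isomorphism between [gr P] and the almost Poisson operad turns leading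
    terms into maps [symbol a : F^a P(n) -> aPois(n)] with kernel [F^(a+1) P(n)],
    compatible with composition and with the symmetric groups.  By symmetry they
    send [f] and [g] to nonzero multiples of the product and of the bracket
    ([symbol_prod], [symbol_bra], [symbol_scalars_neq0]).  Write [ab] for [f (a, b)]
    and [{a, b}] for [g (a, b)], and let
    [A (a, b, c) = (ab)c - a(bc)] and [L (a, b, c) = {ab, c} - {a, c}b - a{b, c}].
    As the relations hold in [gr P], [A] lies in [F^1] and [L] in [F^2].

    Expanding [{(ab)c, d}] and [{a(bc), d}] with the definition of [L] gives the
    identity of [P(4)]
    [{A (a, b, c), d} - A ({a, d}, b, c) - A (a, {b, d}, c) - A (a, b, {c, d})
     = L (ab, c, d) - L (a, bc, d) + L (a, b, d) c - a L (b, c, d)]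
    ([derivation_defect_associator]).  Take the symbols of degree 2.  The symbol of
    [A] is a combination of the [{x, y}z] and the symbol of [L] is a combination of
    the [{{x, y}, z}] ([homogeneous_arity3]).  These can be evaluated in a polynomial
    ring, where the bracket of two variables may be prescribed at will and then
    extends to a biderivation, because no Jacobi identity is required.  Suitable
    evaluations show that the symbol of [L] vanishes ([leibniz_symbol_eq0]), so that
    [L] lies in [F^3 P(3) = 0].  Now the left-hand side vanishes as well; in it the
    terms [{{x, y}, d}z] come from [{A (a, b, c), d}] only, so the symbol of [A] is
    zero and [A] lies in [F^2] ([product_symbol_eq0]).  The same argument in
    degree 3, with the terms [{{{x, y}, z}, d}], gives that [A] lies in
    [F^3 P(3) = 0] ([double_bracket_symbol_eq0]).

    So [f] and [g] satisfy the almost Poisson relations ([rigid_pair]), whence a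
    homomorphism from the almost Poisson operad to [P].  It is onto because [f] and
    [g] generate [P].  It is injective because it maps a combination [x] of
    monomials with [a] brackets and [b] products to an element of [F^a] whose symbol
    is a nonzero multiple of [x] ([symbol_theta]). *)

Set Implicit Arguments.
Unset Strict Implicit.
Unset Printing Implicit Defensive.

Import GRing.Theory.
Local Open Scope ring_scope.
Local Open Scope quotient_scope.

Local Notation "f 'o1' g" := (comp (erefl 4%N : 2 + 2 = 4)%N f ord0 g)
  (at level 40).
Local Notation "f 'o2' g" := (comp (erefl 4%N : 2 + 2 = 4)%N f ord_max g)
  (at level 40).
Local Notation "''i3_' j" := (@Ordinal 3 j isT) (at level 8, j at level 2).
Local Notation "''i4_' j" := (@Ordinal 4 j isT) (at level 8, j at level 2).
Local Notation "x '\o2_' i y" := (comp (erefl 5%N : 3 + 2 = 5)%N x i y)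
  (at level 40, i at level 0).
Local Notation "x '\o3_' i y" := (comp (erefl 5%N : 2 + 3 = 5)%N x i y)
  (at level 40, i at level 0).

(** * Linearity of the operad operations *)

Lemma compZl (k : fieldType) (Q : operad k) l m n (e : (l + m = n.+1)%N) (i : 'I_l)
  c (x : Q l) (y : Q m) : comp e (c *: x) i y = c *: comp e x i y.
Proof. by have := comp_linearl e i y c x 0; rewrite addr0 /= comp0l addr0. Qed.

Lemma compZr (k : fieldType) (Q : operad k) l m n (e : (l + m = n.+1)%N) (i : 'I_l)
  c (x : Q l) (y : Q m) : comp e x i (c *: y) = c *: comp e x i y.
Proof. exact: linearZ. Qed.

Lemma compDl (k : fieldType) (Q : operad k) l m n (e : (l + m = n.+1)%N) (i : 'I_l)
  (x x' : Q l) (y : Q m) : comp e (x + x') i y = comp e x i y + comp e x' i y.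
Proof. by have := comp_linearl e i y 1 x x'; rewrite !scale1r. Qed.

Lemma compDr (k : fieldType) (Q : operad k) l m n (e : (l + m = n.+1)%N) (i : 'I_l)
  (x : Q l) (y y' : Q m) : comp e x i (y + y') = comp e x i y + comp e x i y'.
Proof. by have := comp_linearr e i x 1 y y'; rewrite !scale1r. Qed.

Lemma actD (k : fieldType) (Q : operad k) n (s : 'S_n) (x y : Q n) :
  act s (x + y) = act s x + act s y.
Proof. exact: linearD. Qed.

Lemma actZ (k : fieldType) (Q : operad k) n (s : 'S_n) c (x : Q n) :
  act s (c *: x) = c *: act s x.
Proof. exact: linearZ. Qed.

Lemma actB (k : fieldType) (Q : operad k) n (s : 'S_n) (x y : Q n) :
  act s (x - y) = act s x - act s y.
Proof. exact: linearB. Qed.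

(** * The endomorphism operad of a vector space *)

(** Case analysis on all the comparisons of indices in the goal; [index_cases] then
    closes the cases by integer arithmetic. *)
Ltac split_ifs := repeat match goal with |- context [if ?b then _ else _] =>
  lazymatch b with context [if _ then _ else _] => fail
  | _ => let H := fresh in destruct b eqn:H end end.
Ltac index_cases :=
  rewrite /outer_input; split_ifs => //; by [exfalso; lia | lia | congr (_ _); lia].

Section Endomorphism.
Variables (k : fieldType) (V : lmodType k).
Implicit Types (v w : nat -> V).

(** The family [v] with its entry [i] replaced by [x]. *)
Definition update v i (x : V) : nat -> V := fun j => if j == i then x else v j.

(** The multilinear maps [V^n -> V].  Their arguments are the first [n] entries of a
    family indexed by [nat], so that shifting and renaming inputs need no casts;
    [mfun_local] says that the other entries are irrelevant. *)
Record multilinear n := Multilinear {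
  mfun :> (nat -> V) -> V;
  mfun_local : forall v w, (forall i, (i < n)%N -> v i = w i) -> mfun v = mfun w;
  mfun_linear : forall i, (i < n)%N -> forall v, linear (fun x => mfun (update v i x)) }.

HB.instance Definition _ n := gen_eqMixin (multilinear n).
HB.instance Definition _ n := gen_choiceMixin (multilinear n).

Lemma multilinear_eq n (f g : multilinear n) : (forall v, f v = g v) -> f = g.
Proof.
case: f g => f fl fL [g gl gL] /= fg.
have {}fg : f = g by apply: functional_extensionality_dep.
by case: _ / fg in gl gL *; congr Multilinear; apply: Prop_irrelevance.
Qed.

Section Space.
Variable n : nat.
Implicit Types (f g : multilinear n) (c : k).

Let zero_linear i : (i < n)%N -> forall v, linear (fun x : V => 0 : V).
Proof. by move=> _ v a x y; rewrite scaler0 addr0. Qed.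
Let add_local f g v w : (forall i, (i < n)%N -> v i = w i) -> f v + g v = f w + g w.
Proof. by move=> vw; congr (_ + _); apply: mfun_local. Qed.
Let add_linear f g i : (i < n)%N ->
  forall v, linear (fun x => f (update v i x) + g (update v i x)).
Proof.
by move=> ni v a x y; rewrite !(mfun_linear _ ni) scalerDr addrACA.
Qed.
Let scale_local c f v w : (forall i, (i < n)%N -> v i = w i) -> c *: f v = c *: f w.
Proof. by move=> vw; congr (_ *: _); apply: mfun_local. Qed.
Let scale_linear c f i : (i < n)%N ->
  forall v, linear (fun x => c *: f (update v i x)).
Proof.
by move=> ni v a x y; rewrite !(mfun_linear _ ni) scalerDr !scalerA mulrC.
Qed.

Let ezero := @Multilinear n (fun=> 0) (fun _ _ _ => erefl) zero_linear.
Let eadd f g := Multilinear (@add_local f g) (@add_linear f g).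
Let escale c f := Multilinear (@scale_local c f) (@scale_linear c f).

Let eaddA : associative eadd.
Proof. by move=> f g h; apply: multilinear_eq => v /=; rewrite addrA. Qed.
Let eaddC : commutative eadd.
Proof. by move=> f g; apply: multilinear_eq => v /=; rewrite addrC. Qed.
Let eadd0 : left_id ezero eadd.
Proof. by move=> f; apply: multilinear_eq => v /=; rewrite add0r. Qed.
Let eaddN : left_inverse ezero (escale (-1)) eadd.
Proof. by move=> f; apply: multilinear_eq => v /=; rewrite scaleN1r addNr. Qed.

HB.instance Definition _ :=
  GRing.isZmodule.Build (multilinear n) eaddA eaddC eadd0 eaddN.

Let escaleA c d f : escale c (escale d f) = escale (c * d) f.
Proof. by apply: multilinear_eq => v /=; rewrite scalerA. Qed.
Let escale1 : left_id 1 escale.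
Proof. by move=> f; apply: multilinear_eq => v /=; rewrite scale1r. Qed.
Let escaleDr : right_distributive escale +%R.
Proof. by move=> c f g; apply: multilinear_eq => v /=; rewrite scalerDr. Qed.
Let escaleDl f : {morph escale^~ f : c d / c + d}.
Proof. by move=> c d; apply: multilinear_eq => v /=; rewrite scalerDl. Qed.

HB.instance Definition _ :=
  GRing.Zmodule_isLmodule.Build k (multilinear n) escaleA escale1 escaleDr escaleDl.

Lemma mfunD f g v : (f + g) v = f v + g v. Proof. by []. Qed.
Lemma mfunZ c f v : (c *: f) v = c *: f v. Proof. by []. Qed.
Lemma mfun0 v : (0 : multilinear n) v = 0. Proof. by []. Qed.
Lemma mfunN f v : (- f) v = - f v.
Proof. by rewrite -scaleN1r mfunZ scaleN1r. Qed.

End Space.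

Lemma mid_local v w : (forall i, (i < 1)%N -> v i = w i) -> v 0%N = w 0%N.
Proof. exact. Qed.
Lemma mid_linear i : (i < 1)%N -> forall v, linear (fun x => update v i x 0%N).
Proof. by case: i => // _ v a x y. Qed.
Definition mid : multilinear 1 :=
  @Multilinear 1 (fun v => v 0%N) mid_local mid_linear.

(** A permutation of the inputs, extended by the identity to all indices. *)
Definition perm_nat n (s : 'S_n) (j : nat) : nat :=
  if insub j is Some i then s i else j.

Lemma perm_nat_ord n (s : 'S_n) (i : 'I_n) : perm_nat s i = s i.
Proof. by rewrite /perm_nat valK. Qed.

Lemma perm_nat_lt n (s : 'S_n) j : (j < n)%N -> (perm_nat s j < n)%N.
Proof. by move=> jn; rewrite -[j]/(val (Ordinal jn)) perm_nat_ord. Qed.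

Lemma perm_nat_id n (s : 'S_n) j : (j < n)%N = false -> perm_nat s j = j.
Proof. by move=> jn; rewrite /perm_nat insubF. Qed.

Lemma perm_natM n (s t : 'S_n) j : perm_nat (s * t) j = perm_nat t (perm_nat s j).
Proof.
have [jn|/negbTE jn] := boolP (j < n)%N; last by rewrite !perm_nat_id.
by rewrite -[j]/(val (Ordinal jn)) !perm_nat_ord permM.
Qed.

Lemma perm_nat1 n j : perm_nat (1 : 'S_n)%g j = j.
Proof.
have [jn|/negbTE jn] := boolP (j < n)%N; last by rewrite !perm_nat_id.
by rewrite -[j]/(val (Ordinal jn)) !perm_nat_ord perm1.
Qed.

Lemma perm_nat_inj n (s : 'S_n) : injective (perm_nat s).
Proof.
by apply: (can_inj (g := perm_nat s^-1)) => j; rewrite -perm_natM mulgV perm_nat1.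
Qed.

Lemma perm_nat_eq n (s t : 'S_n) :
  (forall j, (j < n)%N -> perm_nat s j = perm_nat t j) -> s = t.
Proof.
by move=> st; apply/permP => j; apply: val_inj; rewrite /= -!(perm_nat_ord _ j) st.
Qed.

Lemma perm_nat_tperm n (i i' : 'I_n) j :
  perm_nat (tperm i i') j =
  if j == i :> nat then i' : nat else if j == i' :> nat then i : nat else j.
Proof.
have [jn|/negbTE jn] := boolP (j < n)%N; last first.
  rewrite perm_nat_id //; case: eqP jn => [->|_]; first by rewrite ltn_ord.
  by case: eqP => // ->; rewrite ltn_ord.
rewrite -[j]/(val (Ordinal jn)) perm_nat_ord permE /= -!val_eqE /=.
by case: eqP => // _; case: eqP.
Qed.

Section Act.
Variables (n : nat) (s : 'S_n) (f : multilinear n).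
Lemma mact_local v w : (forall i, (i < n)%N -> v i = w i) ->
  f (v \o perm_nat s) = f (w \o perm_nat s).
Proof. by move=> vw; apply: mfun_local => i ni; apply/vw/perm_nat_lt. Qed.
Lemma mact_linear i : (i < n)%N ->
  forall v, linear (fun x => f (update v i x \o perm_nat s)).
Proof.
move=> ni v a x y; pose j := perm_nat s^-1 i.
have uE z : update v i z \o perm_nat s = update (v \o perm_nat s) j z.
  apply: functional_extensionality_dep => h.
  rewrite /update /= -{1}[i](perm_nat1 n) -(mulVg s) perm_natM -/j.
  by rewrite (inj_eq (@perm_nat_inj n s)).
by rewrite !uE mfun_linear //; apply: perm_nat_lt.
Qed.
Definition mact : multilinear n := Multilinear mact_local mact_linear.
End Act.

(** The arguments of the outer operation in a partial composition at slot [i]. *)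
Definition plug m i v (y : V) : nat -> V :=
  fun j => if j == i then y else v (outer_input i m j).

Section Comp.
Variables (l m n : nat) (e : (l + m = n.+1)%N) (f : multilinear l) (i : 'I_l)
  (g : multilinear m).
(** The argument [i] of [f] is the value of [g] on the entries [i, ..., i + m - 1]. *)
Definition mcomp_fun v : V := f (plug m i v (g (fun q => v (i + q)%N))).

Lemma mcomp_local v w : (forall j, (j < n)%N -> v j = w j) ->
  mcomp_fun v = mcomp_fun w.
Proof.
move=> vw; apply: mfun_local => j lj; rewrite /plug; case: eqP => ji.
  apply: mfun_local => q mq; apply: vw; have := ltn_ord i; lia.
apply: vw; have il := ltn_ord i; rewrite /outer_input; case: (ltnP j i) => ij; lia.
Qed.

Lemma mcomp_linear j : (j < n)%N ->
  forall v, linear (fun x => mcomp_fun (update v j x)).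
Proof.
move=> nj v a x y; rewrite /mcomp_fun.
have il := ltn_ord i.
have [/andP[ij jm]|/negP jnot] := boolP ((i <= j) && (j < i + m))%N.
  have gE z : g (fun q => update v j z (i + q)%N) =
              g (update (fun q => v (i + q)%N) (j - i)%N z).
    congr (g _); apply: functional_extensionality_dep => q; rewrite /update.
    by have -> : ((i + q == j) = (q == j - i))%N by lia.
  have pE z u : f (plug m i (update v j z) u) = f (update (plug m i v 0) i u).
    by apply: mfun_local => h hl; rewrite /plug /update; index_cases.
  rewrite !pE !gE mfun_linear; last lia.
  by rewrite mfun_linear.
(* [h] is the slot of [f] that receives input [j] of the composite. *)
pose h := if (j < i)%N then j else (j.+1 - m)%N.
have gE z : g (fun q => update v j z (i + q)%N) = g (fun q => v (i + q)%N).
  by apply: mfun_local => q qm; rewrite /update; case: eqP => // ?; lia.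
have pE z u : f (plug m i (update v j z) u) = f (update (plug m i v u) h z).
  by apply: mfun_local => h' h'l; rewrite /h /plug /update; index_cases.
by rewrite !gE !pE mfun_linear // /h; case: (ltnP j i) => ?; lia.
Qed.
Definition mcomp : multilinear n := Multilinear mcomp_local mcomp_linear.
End Comp.

(** The operad of multilinear operations on [V]. *)
Definition end_operad : operad k.
Proof.
refine (@Operad k multilinear mact mid (@mcomp) _ _ _ _ _ _ _ _ _ _).
- by move=> n s a f g; apply: multilinear_eq.
- move=> n f; apply: multilinear_eq => v /=; apply: mfun_local => i _ /=.
  by rewrite perm_nat1.
- move=> n s t f; apply: multilinear_eq => v /=; apply: mfun_local => i _ /=.
  by rewrite perm_natM.
- by move=> l m n e i g a f f'; apply: multilinear_eq.
- move=> l m n e i f a g g'; apply: multilinear_eq => v /=.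
  rewrite /mcomp_fun /=.
  have pE u : f (plug m i v u) = f (update (plug m i v 0) i u).
    by apply: mfun_local => h _; rewrite /update /plug; case: eqP.
  by rewrite pE mfun_linear // -!pE.
- move=> n e f; apply: multilinear_eq => v /=; rewrite /mcomp_fun /= /plug /=.
  by apply: mfun_local.
- move=> n e f i; apply: multilinear_eq => v /=; rewrite /mcomp_fun /=.
  apply: mfun_local => j jn; rewrite /plug /outer_input addn0 addn1.
  by case: eqP => [->//|_]; case: ltnP.
- move=> l m n p q r e1 e2 e3 e4 x y z i j h hE; apply: multilinear_eq => v /=.
  rewrite /mcomp_fun /= /mcomp_fun; apply: mfun_local => a al.
  have il := ltn_ord i; have jm := ltn_ord j.
  rewrite {1}/plug [in RHS]/plug; case: eqP => ai; last by rewrite /plug; index_cases.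
  apply: mfun_local => b bm; rewrite /plug hE eqn_add2l; case: eqP => bj.
    by apply: mfun_local => c cn; rewrite addnA.
  by index_cases.
- move=> l m n p q r e1 e2 e3 e4 x y z i j h g ij hE gE.
  apply: multilinear_eq => v /=.
  rewrite /mcomp_fun /= /mcomp_fun; apply: mfun_local => a al.
  have il := ltn_ord i; have jl := ltn_ord j.
  move: hE; rewrite /outer_input ltnNge (ltnW ij) /= => hE.
  have [ai|ai] := eqVneq a i.
    rewrite /plug ai eqxx.
    rewrite gE (_ : outer_input j n i = i) ?eqxx; last by index_cases.
    rewrite ltn_eqF //; apply: mfun_local => b bm; rewrite /plug /update; index_cases.
  have [aj|aj] := eqVneq a j.
    rewrite /plug aj eqxx (_ : outer_input i m j = h); last by index_cases.
    rewrite eqxx gtn_eqF //; apply: mfun_local => b bm; rewrite /plug /update; index_cases.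
  rewrite /plug (negbTE ai) (negbTE aj).
  by index_cases.
- move=> l m n e x y i s t u [us ut]; apply: multilinear_eq => v /=.
  rewrite /mcomp_fun /= /mcomp_fun; apply: mfun_local => a al /=.
  have il := ltn_ord i.
  rewrite /plug -(perm_nat_ord s i) (inj_eq (@perm_nat_inj l s)).
  case: eqP => ai.
    apply: mfun_local => b bm /=.
    have hn : (i + b < n)%N by lia.
    rewrite -[b]/(val (Ordinal bm)) -[(i + _)%N]/(val (Ordinal hn)) !perm_nat_ord.
    by rewrite -(ut (Ordinal bm) (Ordinal hn)).
  have hn : (outer_input i m a < n)%N.
    by rewrite /outer_input; case: (ltnP a i) => ?; lia.
  have uE : perm_nat u (outer_input i m a) = u (Ordinal hn).
    by rewrite -[outer_input i m a]/(val (Ordinal hn)) perm_nat_ord.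
  rewrite /= uE -[a]/(val (Ordinal al)) !perm_nat_ord.
  by rewrite -(us (Ordinal al) (Ordinal hn)) //; apply/eqP => /(congr1 val).
Defined.

End Endomorphism.

(** * Homomorphisms of operads *)

(** A homomorphism preserves the linear structures, the symmetric group actions, the
    unit and the partial compositions. *)
Record operad_hom (k : fieldType) (P Q : operad k) := OperadHom {
  hom_fun :> forall n, P n -> Q n;
  hom_linear : forall n, linear (@hom_fun n);
  hom_act : forall n (s : 'S_n) (x : P n), hom_fun (act s x) = act s (hom_fun x);
  hom_id : hom_fun oid = oid;
  hom_comp : forall l m n (e : (l + m = n.+1)%N) (x : P l) (i : 'I_l) (y : P m),
    hom_fun (comp e x i y) = comp e (hom_fun x) i (hom_fun y) }.

Section Hom.
Variables (k : fieldType) (P Q : operad k) (h : operad_hom P Q).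

HB.instance Definition _ n :=
  GRing.isLinear.Build k (P n) (Q n) _ (@hom_fun _ _ _ h n) (@hom_linear _ _ _ h n).

Lemma hom_sum n (I : Type) (r : seq I) (p : pred I) (F : I -> P n) :
  h n (\sum_(i <- r | p i) F i) = \sum_(i <- r | p i) h n (F i).
Proof. exact: linear_sum. Qed.
Lemma homD n (x y : P n) : h n (x + y) = h n x + h n y.
Proof. exact: linearD. Qed.
Lemma homB n (x y : P n) : h n (x - y) = h n x - h n y.
Proof. exact: linearB. Qed.
Lemma homZ n c (x : P n) : h n (c *: x) = c *: h n x.
Proof. exact: linearZ. Qed.
Lemma hom0 n : h n 0 = 0.
Proof. exact: linear0. Qed.

Let ker_set n (x : P n) := h n x = 0.
Let ker_space n : subspace (P n).
Proof.
exists (@ker_set n) => [|a x y]; rewrite /ker_set; first exact: hom0.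
by rewrite homD homZ => -> ->; rewrite scaler0 addr0.
Defined.
Let ker_subseq : subseq P.
Proof.
by exists ker_space => n s x; rewrite /= /ker_set hom_act => ->; exact: linear0.
Defined.
(** The kernel of a homomorphism. *)
Definition hom_ker : ideal P.
Proof.
exists ker_subseq => l m n e x i y; rewrite /= /ker_set hom_comp => ->.
  exact: comp0l.
exact: comp0r.
Defined.

End Hom.

Section QuotientPi.
Variables (k : fieldType) (P : operad k) (I : ideal P) (n : nat).
Implicit Types x y : P n.

Lemma operad_quotient_piD x y : operad_quotient_pi I (x + y) =
  operad_quotient_pi I x + operad_quotient_pi I y.
Proof. by rewrite /operad_quotient_pi linearD. Qed.
Lemma operad_quotient_piB x y : operad_quotient_pi I (x - y) =
  operad_quotient_pi I x - operad_quotient_pi I y.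
Proof. by rewrite /operad_quotient_pi linearB. Qed.
Lemma operad_quotient_pi_eq0 x : I n x -> operad_quotient_pi I x = 0.
Proof.
have <- : operad_quotient_pi I (0 : P n) = 0 by rewrite /operad_quotient_pi linear0.
by move=> Ix; apply/quotient_eq; rewrite subr0.
Qed.

Lemma operad_quotient_pi_act (s : 'S_n) x :
  act s (operad_quotient_pi I x : quotient_operad I n) = operad_quotient_pi I (act s x).
Proof. exact: operad_quotient_actE. Qed.
Lemma operad_quotient_pi_comp l m (e : (l + m = n.+1)%N) (i : 'I_l) (x : P l) (y : P m) :
  comp e (operad_quotient_pi I x : quotient_operad I l) i
    (operad_quotient_pi I y : quotient_operad I m) = operad_quotient_pi I (comp e x i y).
Proof. exact: operad_quotient_compE. Qed.

End QuotientPi.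

Section QuotientHom.
Variables (k : fieldType) (P Q : operad k) (I : ideal P) (h : operad_hom P Q).
Hypothesis h_I : forall n (x : P n), I n x -> h n x = 0.

Let qfun n (x : quotient_operad I n) : Q n := h n (repr x).
Lemma quotient_hom_funE n (x : P n) : qfun (operad_quotient_pi I x) = h n x.
Proof.
apply/eqP; rewrite -subr_eq0 -homB; apply/eqP/h_I.
by rewrite -opprB; apply: subspaceN; apply: quotient_repr.
Qed.

(** The homomorphism induced by [h] on the quotient by an ideal that it kills. *)
Definition quotient_hom : operad_hom (quotient_operad I) Q.
Proof.
exists qfun.
- move=> n a; elim/operad_quotient_ind=> x; elim/operad_quotient_ind=> y.
  by rewrite operad_quotient_piZD !quotient_hom_funE hom_linear.
- move=> n s; elim/operad_quotient_ind=> x.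
  by rewrite [act _ _]operad_quotient_actE !quotient_hom_funE hom_act.
- by rewrite quotient_hom_funE hom_id.
- move=> l m n e; elim/operad_quotient_ind=> x i; elim/operad_quotient_ind=> y.
  by rewrite [X in qfun X]operad_quotient_compE !quotient_hom_funE hom_comp.
Defined.

Lemma quotient_homE n (x : P n) : quotient_hom n (operad_quotient_pi I x) = h n x.
Proof. exact: quotient_hom_funE. Qed.

End QuotientHom.

Section FreeHom.
Variables (k : fieldType) (E : nat -> Type) (Q : operad k) (g : forall n, E n -> Q n).

(** The homomorphism from the free operad that extends the map [g] on generators. *)
Definition free_hom : operad_hom (free_operad k E) Q.
Proof.
exists (fun n (x : free_space k E n) => term_eval g (repr x)).
- by move=> n a x y; rewrite free_linearE term_eval_repr.
- by move=> n s x; rewrite [act _ _]/(free_act _ _) term_eval_repr.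
- by rewrite term_eval_repr.
- by move=> l m n e x i y; rewrite [comp _ _ _ _]/(free_comp _ _ _ _) term_eval_repr.
Defined.

Lemma free_homE n (a : E n) : free_hom n (free_gen k a) = g a.
Proof. exact: term_eval_repr. Qed.

End FreeHom.

(** [f] and [g] satisfy in [Q] the defining relations of the commutative product
    and of the bracket of almost Poisson algebras. *)
Record ap_pair (k : fieldType) (Q : operad k) (f g : Q 2%N) : Prop := ApPair {
  ap_pair_comm : act swap12 f = f;
  ap_pair_anticomm : act swap12 g = - g;
  ap_pair_assoc : f o1 f = f o2 f :> Q 3%N;
  ap_pair_leibniz : g o1 f = act swap23 (f o1 g) + f o2 g :> Q 3%N }.

Section ApHom.
Variables (k : fieldType).

(** The product and the bracket of the almost Poisson operad. *)
Definition aprod : almost_poisson k 2 :=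
  operad_quotient_pi _ (free_gen k ap_product).
Definition abra : almost_poisson k 2 :=
  operad_quotient_pi _ (free_gen k ap_bracket).

Lemma almost_poisson_pair : ap_pair aprod abra.
Proof.
have relE n (x : free_operad k ap_generator n) : ap_relation x ->
    operad_quotient_pi (ideal_gen (@ap_relation k)) x = 0.
  by move=> Rx; apply: operad_quotient_pi_eq0 => J; apply.
split; apply/eqP; rewrite -subr_eq0 ?opprK /aprod /abra;
  rewrite ?operad_quotient_pi_comp ?operad_quotient_pi_act.
- by rewrite -operad_quotient_piB; apply/eqP/relE/ap_comm.
- by rewrite -operad_quotient_piD; apply/eqP/relE/ap_anticomm.
- by rewrite -operad_quotient_piB; apply/eqP/relE/ap_assoc.
- rewrite -[X in _ - X]operad_quotient_piD -operad_quotient_piB.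
  exact/eqP/relE/ap_leibniz.
Qed.

Variables (Q : operad k) (f g : Q 2%N) (fgP : ap_pair f g).

Let gen_fun n (a : ap_generator n) : Q n :=
  match a in ap_generator n return Q n with ap_product => f | ap_bracket => g end.

Let free_kernel n (x : free_operad k ap_generator n) :
  ideal_gen (@ap_relation k) n x -> free_hom gen_fun n x = 0.
Proof.
move=> /(_ (hom_ker (free_hom gen_fun))); apply=> {n x} n x Rx.
suff: free_hom gen_fun n x = 0 by [].
case: Rx; rewrite ?homB ?homD ?(hom_act, hom_comp, free_homE) /=.
- by rewrite (ap_pair_comm fgP) subrr.
- by rewrite (ap_pair_anticomm fgP) addNr.
- by rewrite (ap_pair_assoc fgP) subrr.
- by rewrite (ap_pair_leibniz fgP) subrr.

Qed.

(** The universal property of the almost Poisson operad: the homomorphism sending the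
    product and the bracket to [f] and [g]. *)
Definition ap_hom : operad_hom (almost_poisson k) Q :=
  quotient_hom free_kernel.

Lemma ap_hom_prod : ap_hom 2 aprod = f.
Proof. by rewrite [LHS]quotient_homE free_homE. Qed.
Lemma ap_hom_bra : ap_hom 2 abra = g.
Proof. by rewrite [LHS]quotient_homE free_homE. Qed.

End ApHom.

(** * Almost Poisson brackets on polynomials *)

Section PolynomialBracket.
Variables (k : fieldType) (N : nat) (T : seq ('I_N * 'I_N * 'I_N)).
Local Notation A := {mpoly k[N]}.
Implicit Types p q r : A.

(** The sum over the triples [(i, j, h)] in [T] of [x_h (d_i p d_j q - d_j p d_i q)].
    It is an antisymmetric biderivation; for distinct [i] and [j] the triple
    [(i, j, h)] contributes [x_h] to the bracket of [x_i] and [x_j]. *)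
Definition poly_bracket p q : A :=
  \sum_(t <- T) 'X_t.2 * (p^`M(t.1.1) * q^`M(t.1.2) - q^`M(t.1.1) * p^`M(t.1.2)).

Lemma poly_bracketC p q : poly_bracket p q = - poly_bracket q p.
Proof.
by rewrite /poly_bracket -sumrN; apply: eq_bigr => t _; ring.
Qed.

Lemma poly_bracketPl c p q r :
  poly_bracket (c *: p + q) r = c *: poly_bracket p r + poly_bracket q r.
Proof.
rewrite /poly_bracket scaler_sumr -big_split; apply: eq_bigr => t _ /=.
rewrite !linearP /= -!mul_mpolyC; ring.
Qed.

Lemma poly_bracketPr c p q r :
  poly_bracket r (c *: p + q) = c *: poly_bracket r p + poly_bracket r q.
Proof.
by rewrite poly_bracketC poly_bracketPl opprD -scalerN -!poly_bracketC.
Qed.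

Lemma poly_bracketMl p q r :
  poly_bracket (p * q) r = poly_bracket p r * q + p * poly_bracket q r.
Proof.
rewrite /poly_bracket mulr_suml mulr_sumr -big_split; apply: eq_bigr => t _ /=.
rewrite !mderivM; ring.
Qed.

Lemma poly_bracketZl c p q : poly_bracket (c *: p) q = c *: poly_bracket p q.
Proof.
have := poly_bracketPl c p 0 q; rewrite addr0 => ->.
have := poly_bracketPl (-1) 0 0 q; rewrite scaler0 addr0 scaleN1r addNr => ->.
by rewrite addr0.
Qed.
Lemma poly_bracketX i j : poly_bracket 'X_i 'X_j =
  \sum_(t <- T) (((t.1.1 == i) && (t.1.2 == j))%:R -
                ((t.1.1 == j) && (t.1.2 == i))%:R) * 'X_t.2.
Proof.
have dX (h g : 'I_N) : 'X_h^`M(g) = (g == h)%:R :> A.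
  rewrite mderivX mnm1E eq_sym; case: eqP => [->|_]; last by rewrite scale0r.
  by rewrite scale1r -{1}[U_(h)%MM]add0m addmK mpolyX0.
apply: eq_bigr => t _; rewrite !dX mulrC -!natrM !mulnb.
by [].
Qed.

Lemma mul2_local (v w : nat -> A) : (forall i, (i < 2)%N -> v i = w i) ->
  v 0%N * v 1%N = w 0%N * w 1%N.
Proof. by move=> vw; rewrite !vw. Qed.
Lemma mul2_linear i : (i < 2)%N -> forall v : nat -> A,
  linear (fun x => update v i x 0 * update v i x 1).
Proof.
case: i => [|[|//]] _ v c x y; rewrite /update /=.
  by rewrite mulrDl scalerAl.
by rewrite mulrDr scalerAr.
Qed.
Definition mul2 : end_operad A 2 := Multilinear mul2_local mul2_linear.

Lemma bra2_local (v w : nat -> A) : (forall i, (i < 2)%N -> v i = w i) ->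
  poly_bracket (v 0%N) (v 1%N) = poly_bracket (w 0%N) (w 1%N).
Proof. by move=> vw; rewrite !vw. Qed.
Lemma bra2_linear i : (i < 2)%N -> forall v : nat -> A,
  linear (fun x => poly_bracket (update v i x 0) (update v i x 1)).
Proof.
case: i => [|[|//]] _ v c x y; rewrite /update /=.
  exact: poly_bracketPl.
exact: poly_bracketPr.
Qed.
Definition bra2 : end_operad A 2 := Multilinear bra2_local bra2_linear.

Lemma poly_pair : ap_pair mul2 bra2.
Proof.
split; apply: multilinear_eq => v.
- by rewrite /= !perm_nat_tperm mulrC.
- by rewrite mfunN /= !perm_nat_tperm; exact: poly_bracketC.
- by rewrite /= /mcomp_fun /plug /= mulrA.
- rewrite [RHS]mfunD /= /mcomp_fun /plug /= poly_bracketMl.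
  by rewrite !perm_nat_tperm.
Qed.

(** The representation of the almost Poisson operad on the polynomial ring with this
    bracket. *)
Definition poly_model : operad_hom (almost_poisson k) (end_operad A) :=
  ap_hom poly_pair.

End PolynomialBracket.

(** * Homogeneous elements *)

(** The suboperad generated by [f] and [g] is the whole operad. *)
Definition generates (k : fieldType) (Q : operad k) (f g : Q 2%N) : Prop :=
  forall S : suboperad Q, S 2%N f -> S 2%N g -> forall m (x : Q m), S m x.

Section Homogeneous.
Variables (k : fieldType) (Q : operad k) (f g : Q 2%N).

(** [homogeneous a b x]: [x] is a linear combination of composites, with any
    labelling of the inputs, of [a] copies of [g] and [b] copies of [f]. *)
Inductive homogeneous : nat -> nat -> forall n, Q n -> Prop :=
| homogeneous_id : homogeneous 0 0 oid
| homogeneous_left : homogeneous 0 1 f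
| homogeneous_right : homogeneous 1 0 g
| homogeneous_comp a b a' b' l m n (e : (l + m = n.+1)%N) (x : Q l) (i : 'I_l) (y : Q m) :
    homogeneous a b x -> homogeneous a' b' y ->
    homogeneous (a + a') (b + b') (comp e x i y)
| homogeneous_act a b n (s : 'S_n) (x : Q n) :
    homogeneous a b x -> homogeneous a b (act s x)
| homogeneous0 a b n : (a + b).+1 = n -> homogeneous a b (0 : Q n)
| homogeneousZD a b n c (x y : Q n) :
    homogeneous a b x -> homogeneous a b y -> homogeneous a b (c *: x + y).

Lemma homogeneous_arity a b n (x : Q n) : homogeneous a b x -> n = (a + b).+1.
Proof. elim=> //=; lia. Qed.

Definition degree_ge_gen a n (x : Q n) : Prop :=
  exists a' b, (a <= a')%N /\ homogeneous a' b x.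

(** The span of the homogeneous elements with at least [a] copies of [g]. *)
Definition degree_ge a n : subspace (Q n) := span (@degree_ge_gen a n).

Lemma degree_ge_homogeneous a b n (x : Q n) : homogeneous a b x -> degree_ge a n x.
Proof. by move=> xh W; apply; exists a, b. Qed.

Lemma degree_ge_act a n (s : 'S_n) (x : Q n) : degree_ge a n x -> degree_ge a n (act s x).
Proof.
apply: span_linear; first exact: act_linear.
move=> y [a' [b [aa' yh]]] W; apply; exists a', b; split=> //.
exact: homogeneous_act.
Qed.

Lemma degree_ge_comp a b l m n (e : (l + m = n.+1)%N) (x : Q l) (i : 'I_l) (y : Q m) :
  degree_ge a l x -> degree_ge b m y -> degree_ge (a + b) n (comp e x i y).
Proof.
move=> xa yb; move: x xa; apply: span_linear; first exact: comp_linearl.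
move=> x [a' [c [aa' xh]]]; move: y yb; apply: span_linear; first exact: comp_linearr.
move=> y [b' [d [bb' yh]]] W; apply; exists (a' + b')%N, (c + d)%N.
by split; [lia|apply: homogeneous_comp].
Qed.

Lemma degree_ge_le a b n (x : Q n) : (b <= a)%N -> degree_ge a n x -> degree_ge b n x.
Proof.
move=> ba; apply: (span_linear (f := id)) => // y [a' [c [aa' yh]]] W; apply.
by exists a', c; split=> //; apply: leq_trans aa'.
Qed.

Lemma degree_ge_eq0 a n (x : Q n) : (n <= a)%N -> degree_ge a n x -> x = 0.
Proof.
move=> na xa.
have zD c (y z : Q n) : y = 0 -> z = 0 -> c *: y + z = 0.
  by move=> -> ->; rewrite scaler0 addr0.
apply: (xa (Subspace (erefl : (fun y => y = 0) 0) zD)) => y [a' [b [aa' /homogeneous_arity]]].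
lia.
Qed.

Definition degree_ge_subseq a : subseq Q := Subseq (@degree_ge_act a).

(** The suboperad spanned by all homogeneous elements. *)
Definition monomial_suboperad : suboperad Q.
Proof.
exists (degree_ge_subseq 0) => [|l m n e x i y xW yW].
  exact/degree_ge_homogeneous/homogeneous_id.
exact: (degree_ge_comp e i xW yW).
Defined.

Hypothesis fg_gen : generates f g.

Lemma degree_ge0 n (x : Q n) : degree_ge 0 n x.
Proof.
by apply: (fg_gen (S := monomial_suboperad));
  [exact/degree_ge_homogeneous/homogeneous_left
  |exact/(degree_ge_le (leq0n 1))/degree_ge_homogeneous/homogeneous_right].
Qed.

Definition degree_ge_ideal : ideal Q.
Proof.
exists (degree_ge_subseq 1) => l m n e x i y => [xW|yW].
  rewrite /= -[1%N]addn0; apply: degree_ge_comp => //; exact: degree_ge0.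
rewrite /= -[1%N]add0n; apply: degree_ge_comp => //; exact: degree_ge0.
Defined.

Let F := ideal_filtration (ideal_gen1 g).

Lemma homogeneous_power a b n (x : Q n) : homogeneous a b x -> F a n x.
Proof.
elim=> {a b n x}.
- exact: filt0.
- exact: filt0.
- move=> W; apply; apply: tree_ideal_vertex => J; apply; exact: Singleton.
- by move=> a b a' b' l m n e x i y _ IHx _ IHy; apply: filt_comp.
- by move=> a b n s x _; apply: subseq_act.
- move=> *; exact: subspace0.
- move=> *; exact: subspaceZD.
Qed.

(** With [homogeneous_power], this identifies the filtration by powers of the ideal
    generated by [g] with the filtration by the number of copies of [g]. *)
Lemma power_degree_ge a n (x : Q n) : F a n x -> degree_ge a n x.
Proof.
apply: (span_linear (f := id)) => // {}x tx.
suff xW : degree_ge a n x by move=> W WS; apply: xW.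
elim: tx => {a n x}.
- exact/degree_ge_homogeneous/homogeneous_id.
- move=> n x; exact: degree_ge0.
- move=> n x Ix; apply: (Ix degree_ge_ideal) => m y [].
  exact/degree_ge_homogeneous/homogeneous_right.
- by move=> a b l m n e x i y _ IHx _ IHy; apply: degree_ge_comp.
- by move=> a n s x _; apply: degree_ge_act.
Qed.

Lemma power_eq0 a n (x : Q n) : (n <= a)%N -> F a n x -> x = 0.
Proof. by move=> na /power_degree_ge; apply: degree_ge_eq0. Qed.

End Homogeneous.

Section LowArity.
Variables (k : fieldType) (Q : operad k) (f g : Q 2%N).
Hypotheses (fC : act swap12 f = f) (gC : act swap12 g = - g).

Lemma perm2_cases (s : 'S_2) : s = 1%g \/ s = swap12.
Proof.
have s0 := perm_nat_lt s (isT : 0 < 2)%N; have s1 := perm_nat_lt s (isT : 1 < 2)%N.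
have s01 : perm_nat s 0 <> perm_nat s 1 by move/perm_nat_inj.
case: (posnP (perm_nat s 0)) => s0E; [left|right]; apply: perm_nat_eq => -[|[|//]] _;
  rewrite ?perm_nat1 ?perm_nat_tperm /=; lia.
Qed.

(** The elements of arity at most 2 built from [a] copies of [g]: the multiples of the
    identity, of [f] or of [g].  No condition is imposed in the other arities. *)
Definition low_arity_form a n : Q n -> Prop :=
  match n return Q n -> Prop with
  | 1 => fun x => exists c, x = c *: oid
  | 2 => fun x => exists c, x = c *: (if a is 0%N then f else g)
  | _ => fun=> True
  end.

Lemma low_arity_form_act a n (s : 'S_n) (x : Q n) :
  low_arity_form a x -> low_arity_form a (act s x).
Proof.
case: n s x => [|[|[|n]]] //= s x [c ->]; rewrite linearZ /=.
  exists c; congr (_ *: _); rewrite (_ : s = 1%g) ?act1 //.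
  by apply/permP => j; rewrite !ord1.
case: (perm2_cases s) => ->; first by exists c; rewrite act1.
case: a => [|a]; first by exists c; rewrite fC.
by exists (- c); rewrite gC scalerN scaleNr.
Qed.

Lemma comp_scale_idl n c (e : (1 + n = n.+1)%N) (i : 'I_1) (x : Q n) :
  comp e (c *: oid) i x = c *: x.
Proof. by rewrite compZl ord1 comp_idl. Qed.

Lemma comp_scale_idr n c (e : (n + 1 = n.+1)%N) (i : 'I_n) (x : Q n) :
  comp e x i (c *: oid) = c *: x.
Proof. by rewrite compZr comp_idr. Qed.

Lemma low_arity_formZ a n c (x : Q n) : low_arity_form a x -> low_arity_form a (c *: x).
Proof.
by case: n x => [|[|[|n]]] //= x [d ->]; exists (c * d); rewrite scalerA.
Qed.

Lemma low_arity_form_ge3 a n (x : Q n) : (2 < n)%N -> low_arity_form a x.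
Proof. by case: n x => [|[|[|n]]]. Qed.

Lemma homogeneous_low a b n (x : Q n) : homogeneous f g a b x -> low_arity_form a x.
Proof.
elim=> {a b n x} /=.
- by exists 1; rewrite scale1r.
- by exists 1; rewrite scale1r.
- by exists 1; rewrite scale1r.
- move=> a b a' b' l m n e x i y /homogeneous_arity la IHx /homogeneous_arity ma IHy.
  have [n3|n2] := ltnP 2 n; first exact: low_arity_form_ge3.
  case: (l =P 1%N) => l1.
    have [a0 mn] : a = 0%N /\ m = n by lia.
    clear la ma; subst a l m; rewrite add0n.
    have [c ->] : exists c, x = c *: oid := IHx.
    by rewrite comp_scale_idl; apply: low_arity_formZ.
  have [a0 [ln m1]] : a' = 0%N /\ l = n /\ m = 1%N by lia.
  clear la ma; subst a' l m; rewrite addn0.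
  have [c ->] : exists c, y = c *: oid := IHy.
  by rewrite comp_scale_idr; apply: low_arity_formZ.
- by move=> a b n s x _; apply: low_arity_form_act.
- move=> a b n _; rewrite -(scale0r (0 : Q n)).
  case: n => [|[|[|n]]] //=; exists 0; by rewrite !scale0r.
- move=> a b n c x y _ + _; case: n x y => [|[|[|n]]] //= x y [p ->] [q ->];
    exists (c * p + q); by rewrite scalerDl scalerA.
Qed.

End LowArity.

(** * Leading terms in the associated graded operad *)

Section Symbol.
Variables (k : fieldType) (P : operad k) (F : filtration P).

Lemma filt_le a b n (x : P n) : (b <= a)%N -> F a n x -> F b n x.
Proof.
move=> ba Fx; elim: a ba Fx => [|a IH]; first by rewrite leqn0 => /eqP ->.
by rewrite leq_eqVlt => /orP[/eqP -> //|ba] /filtS; apply: IH.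
Qed.

(** The family of representatives with [x] in degree [a] and 0 elsewhere. *)
Definition at_degree n a (x : P n) (b : nat) : P n := if b == a then x else 0.

Lemma at_degree_filt n a (x : P n) : F a n x -> forall b, F b n (at_degree a x b).
Proof. by move=> Fx b; rewrite /at_degree; case: eqP => [->//|_]; apply: subspace0. Qed.

Lemma at_degree_finite n a (x : P n) :
  exists N, forall b, (N <= b)%N -> F b.+1 n (at_degree a x b).
Proof.
exists a.+1 => b ab; rewrite /at_degree gtn_eqF //; exact: subspace0.
Qed.

(** The class of [x] in [F^a / F^(a+1)], as an element of the associated graded
    operad; 0 is a default value for [x] outside [F^a]. *)
Definition leading a n (x : P n) : gr F n :=
  if pselect (F a n x) is left Fx then of_lift (at_degree_filt Fx) (at_degree_finite a x)
  else 0.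

Lemma lifts_leading a n (x : P n) : F a n x -> lifts (at_degree a x) (leading a x).
Proof. by rewrite /leading => Fx; case: pselect => // Fx'; apply: lifts_of. Qed.

Lemma leadingP a n c (x y : P n) : F a n x -> F a n y ->
  leading a (c *: x + y) = c *: leading a x + leading a y.
Proof.
move=> Fx Fy; have Fxy : F a n (c *: x + y) by apply: subspaceZD.
apply: (lifts_eq1 (lifts_leading Fxy)
  (lifts_linear c (lifts_leading Fx) (lifts_leading Fy))) => b.
by rewrite /at_degree; case: eqP => // _; rewrite scaler0 addr0.
Qed.

Lemma leading_id : leading 0 oid = oid.
Proof.
apply: (lifts_eq1 (lifts_leading (filt0 F oid)) (lifts_id F)) => b.
by rewrite /at_degree /gr_id_rep; case: b.
Qed.

Lemma leading_act a n (s : 'S_n) (x : P n) : F a n x ->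
  leading a (act s x) = act s (leading a x).
Proof.
move=> Fx; have Fsx : F a n (act s x) by apply: subseq_act.
apply: (lifts_eq1 (lifts_leading Fsx) (lifts_act s (lifts_leading Fx))) => b.
rewrite /at_degree /gr_act_rep; case: eqP => // _; by rewrite linear0.
Qed.

Lemma leading_comp a b l m n (e : (l + m = n.+1)%N) (x : P l) (i : 'I_l) (y : P m) :
  F a l x -> F b m y ->
  leading (a + b) (comp e x i y) = comp e (leading a x) i (leading b y).
Proof.
move=> Fx Fy; have Fxy : F (a + b)%N n (comp e x i y) by apply: filt_comp.
apply: (lifts_eq1 (lifts_leading Fxy)
  (lifts_comp e i (lifts_leading Fx) (lifts_leading Fy))) => c.
rewrite /gr_comp_rep /at_degree; case: eqP => [->|cab].
  have ab : (a < (a + b).+1)%N by lia.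
  rewrite (bigD1 (Ordinal ab)) //= eqxx addKn eqxx big1 ?addr0 // => j.
  by rewrite -val_eqE /= => /negbTE ->; rewrite comp0l.
rewrite big1 // => j _; case: eqP => [ja|_]; last by rewrite comp0l.
by case: eqP => [jb|_]; [have := ltn_ord j; lia|rewrite comp0r].
Qed.

Lemma leading_eq0 a n (x : P n) : F a n x -> (leading a x = 0 <-> F a.+1 n x).
Proof.
move=> Fx; have [_ /(_ a)] := lifts_leading Fx; rewrite /at_degree eqxx => xa.
split=> [x0|Fx1].
  rewrite -[x]subr0; apply/quotient_eq; rewrite -xa x0 linear0 //.
apply: graded_eq => b; have [_ ->] := lifts_leading Fx; rewrite /at_degree.
rewrite [RHS](_ : _ = \pi_(quotient (F b.+1 n)) 0); last by rewrite linear0.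
by apply/quotient_eq; rewrite subr0; case: eqP => [->//|_]; apply: subspace0.
Qed.

End Symbol.

(** * Operations of arity three *)

(** [block_perm] in terms of natural number indices. *)
Lemma block_permP l m n (i : 'I_l) (s : 'S_l) (t : 'S_m) (u : 'S_n) :
  (forall j, (j < l)%N -> j != i ->
    perm_nat u (outer_input i m j) = outer_input (perm_nat s i) m (perm_nat s j)) ->
  (forall j, (j < m)%N -> perm_nat u (i + j)%N = (perm_nat s i + perm_nat t j)%N) ->
  block_perm i s t u.
Proof.
move=> us ut; split=> j h.
  by move=> ji hE; rewrite -!perm_nat_ord hE us.
by move=> hE; rewrite -!perm_nat_ord hE ut.
Qed.

(** The transposition [0 <-> 1] and the rotation [0 -> 1 -> 2 -> 0] of three inputs. *)
Definition swap12_3 : 'S_3 := tperm ord0 (@Ordinal 3 1 isT).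
Definition rot3 : 'S_3 := (tperm ord0 ord_max * swap23)%g.

Definition perm_natE := (perm_natM, perm_nat1, perm_nat_tperm).

Section Arity3.
Variables (k : fieldType) (Q : operad k).

Lemma comp_swap_o2 (x y : Q 2%N) : act swap12 x o2 y = act rot3 (x o1 y) :> Q 3%N.
Proof.
have b : block_perm ord0 swap12 (1%g : 'S_2) rot3.
  by apply: block_permP => -[|[|j]] //; rewrite ?perm_natE.
have := comp_act (erefl : 2 + 2 = 4)%N x y b.
by rewrite tpermL act1.
Qed.

Lemma comp_o1_swap (x y : Q 2%N) : x o1 act swap12 y = act swap12_3 (x o1 y) :> Q 3%N.
Proof.
have b : block_perm ord0 (1%g : 'S_2) swap12 swap12_3.
  by apply: block_permP => -[|[|j]] //; rewrite ?perm_natE.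
have := comp_act (erefl : 2 + 2 = 4)%N x y b.
by rewrite perm1 act1.
Qed.

Lemma perm3_cases (s : 'S_3) : exists (b : bool) (i : 'I_3),
  s = ((if b then swap12_3 else 1) * rot3 ^+ i)%g.
Proof.
have [s0 s1 s2] : [/\ (perm_nat s 0 < 3)%N, (perm_nat s 1 < 3)%N & (perm_nat s 2 < 3)%N].
  by split; apply: perm_nat_lt.
have [s01 s02 s12] : [/\ perm_nat s 0 <> perm_nat s 1, perm_nat s 0 <> perm_nat s 2
  & perm_nat s 1 <> perm_nat s 2] by split=> /perm_nat_inj.
suff [b [i [i3 siE]]] : exists (b : bool) i, (i < 3)%N /\ forall j, (j < 3)%N ->
    perm_nat s j = perm_nat ((if b then swap12_3 else 1) * rot3 ^+ i)%g j.
  by exists b, (Ordinal i3); apply: perm_nat_eq.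
(* [s] is a power of the rotation exactly when it sends 0 and 1 to cyclically
   consecutive inputs. *)
pose b := (perm_nat s 1 != (perm_nat s 0).+1 %% 3)%N.
exists b, (if b then perm_nat s 1 else perm_nat s 0); split; first by case: b.
rewrite /b; move: s0 s1 s2 s01 s02 s12.
move: (perm_nat s) => u.
case E0: (u 0%N) => [|[|[|//]]] _; case E1: (u 1%N) => [|[|[|//]]] // _;
  case E2: (u 2%N) => [|[|[|//]]] // _ _ _ _ [|[|[|//]]] _;
  by rewrite ?E0 ?E1 ?E2 /= ?expg0 ?expg1 ?expgS ?expg0 !perm_natE.
Qed.

(** [x] is a combination of the three rotations of [X].  When [X] is antisymmetric in
    its first two inputs, this is the submodule generated by [X] ([rot_span_act]). *)
Definition rot_span (X x : Q 3%N) : Prop := exists p q r : k,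
  x = p *: X + q *: act rot3 X + r *: act (rot3 ^+ 2) X.

Lemma rot_spanZD X c x y : rot_span X x -> rot_span X y -> rot_span X (c *: x + y).
Proof.
move=> [p [q [r ->]]] [p' [q' [r' ->]]]; exists (c * p + p'), (c * q + q'), (c * r + r').
rewrite !scalerDl !scalerDr !scalerA.
by rewrite addrACA; congr (_ + _); rewrite addrACA.
Qed.

Lemma rot_span0 X : rot_span X 0.
Proof. by exists 0, 0, 0; rewrite !scale0r !addr0. Qed.

Lemma rot_spanZ X c x : rot_span X x -> rot_span X (c *: x).
Proof. by move=> Xx; have := rot_spanZD c Xx (rot_span0 X); rewrite addr0. Qed.

Lemma rot_span_id X : rot_span X X.
Proof. by exists 1, 0, 0; rewrite scale1r !scale0r !addr0. Qed.

Lemma rot_span_act X s x : act swap12_3 X = - X -> rot_span X x -> rot_span X (act s x).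
Proof.
move=> XN; have sX t : rot_span X (act t X).
  have [b [i ->]] := perm3_cases t; rewrite actM.
  suff iX : rot_span X (act (rot3 ^+ i) X).
    case: b; last by rewrite act1.
    by rewrite XN linearN -scaleN1r; apply: rot_spanZ.
  case: i => -[|[|[|//]]] i3; rewrite ?expg0 ?expg1.
  - by rewrite act1; apply: rot_span_id.
  - by exists 0, 1, 0; rewrite scale1r !scale0r addr0 add0r.
  - by exists 0, 0, 1; rewrite scale1r !scale0r !add0r.
move=> [p [q [r ->]]]; rewrite !linearD !linearZ /= -!actM addrC.
apply: rot_spanZD => //; rewrite addrC; apply: rot_spanZD => //.
exact: rot_spanZ.
Qed.

Variables (f g : Q 2%N) (fg : ap_pair f g).

(** The elements of arity 3 with at least one bracket: combinations of the [{x, y}z]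
    for [a = 1], of the [{{x, y}, z}] for [a >= 2].  No condition is imposed in the
    other cases. *)
Definition arity3_form a n : Q n -> Prop :=
  match n return Q n -> Prop with
  | 3 => fun x => match a with
    | 0 => True
    | 1 => rot_span (f o1 g) x
    | _ => rot_span (g o1 g) x end
  | _ => fun=> True
  end.

Lemma fg_swap : act swap12_3 (f o1 g) = - (f o1 g) :> Q 3%N.
Proof. by rewrite -comp_o1_swap (ap_pair_anticomm fg) -linearN. Qed.

Lemma gg_swap : act swap12_3 (g o1 g) = - (g o1 g) :> Q 3%N.
Proof. by rewrite -comp_o1_swap (ap_pair_anticomm fg) -linearN. Qed.

Lemma arity3_formZD a n c (x y : Q n) :
  arity3_form a x -> arity3_form a y -> arity3_form a (c *: x + y).
Proof.
by case: n x y => [|[|[|[|n]]]] // x y; case: a => [|[|a]] //; apply: rot_spanZD.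
Qed.

Lemma arity3_form0 a n : arity3_form a (0 : Q n).
Proof. by case: n => [|[|[|[|n]]]] //; case: a => [|[|a]] //; apply: rot_span0. Qed.

Lemma arity3_formZ a n c (x : Q n) : arity3_form a x -> arity3_form a (c *: x).
Proof. by move=> ax; have := arity3_formZD c ax (arity3_form0 a n); rewrite addr0. Qed.

Lemma arity3_form_act a n (s : 'S_n) (x : Q n) : arity3_form a x -> arity3_form a (act s x).
Proof.
case: n s x => [|[|[|[|n]]]] // s x; case: a => [|[|a]] //; apply: rot_span_act.
  exact: fg_swap.
exact: gg_swap.
Qed.

Lemma arity3_form_not3 a n (x : Q n) : n <> 3%N -> arity3_form a x.
Proof. by case: n x => [|[|[|[|n]]]]. Qed.

Let fo2 (y : Q 2%N) : f o2 y = act rot3 (f o1 y) :> Q 3%N.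
Proof. by rewrite -comp_swap_o2 (ap_pair_comm fg). Qed.

Let go2 (y : Q 2%N) : g o2 y = - act rot3 (g o1 y) :> Q 3%N.
Proof.
rewrite -comp_swap_o2 (ap_pair_anticomm fg) -(scaleN1r g).
by rewrite compZl scaleN1r opprK.
Qed.

(** The composites of two binary generators, rewritten by the Leibniz rule when a
    product is plugged into the bracket. *)
Lemma arity3_form_binary a a' (i : 'I_2) : (a <= 1)%N -> (a' <= 1)%N ->
  arity3_form (a + a') (comp (erefl : 2 + 2 = 4)%N (if a is 0%N then f else g) i
                       (if a' is 0%N then f else g) : Q 3%N).
Proof.
have rot X : act swap12_3 X = - X -> rot_span X (act rot3 X).
  by move=> XN; apply: rot_span_act XN (rot_span_id _).
have go1f : rot_span (f o1 g) (g o1 f).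
  rewrite (ap_pair_leibniz fg) fo2 -[act swap23 _]scale1r.
  by apply: rot_spanZD; apply: rot_span_act fg_swap (rot_span_id _).
have [->|->] : i = ord0 \/ i = ord_max.
  by case: i => -[|[|//]] i2; [left|right]; apply: val_inj.
  case: a a' => [|[|//]] [|[|//]] //= _ _; exact: rot_span_id.
case: a a' => [|[|//]] [|[|//]] //= _ _.
- by rewrite fo2; apply/rot/fg_swap.
- rewrite go2 -scaleN1r; apply: rot_spanZ; apply: rot_span_act => //.
  exact: fg_swap.
- by rewrite go2 -scaleN1r; apply/rot_spanZ/rot/gg_swap.
Qed.

Lemma homogeneous_arity3 a b n (x : Q n) : homogeneous f g a b x -> arity3_form a x.
Proof.
elim=> {a b n x} //.
- move=> a b a' b' l m n e x i y xh IHx yh IHy.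
  have la := homogeneous_arity xh; have ma := homogeneous_arity yh.
  have [n3|n3] := eqVneq n 3%N; last by apply: arity3_form_not3; apply/eqP.
  case: (l =P 1%N) => l1.
    have [a0 mn] : a = 0%N /\ m = n by lia.
    have xs := homogeneous_low (ap_pair_comm fg) (ap_pair_anticomm fg) xh.
    clear la ma xh yh IHx; subst a l m; rewrite add0n.
    have [c ->] : exists c, x = c *: oid := xs.
    by rewrite comp_scale_idl; apply: arity3_formZ.
  case: (m =P 1%N) => m1.
    have [a0 ln] : a' = 0%N /\ l = n by lia.
    have ys := homogeneous_low (ap_pair_comm fg) (ap_pair_anticomm fg) yh.
    clear la ma xh yh IHy; subst a' l m; rewrite addn0.
    have [c ->] : exists c, y = c *: oid := ys.
    by rewrite comp_scale_idr; apply: arity3_formZ.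
  have [l2 m2] : l = 2%N /\ m = 2%N by lia.
  have [a1 a'1] : (a <= 1)%N /\ (a' <= 1)%N by lia.
  have xs := homogeneous_low (ap_pair_comm fg) (ap_pair_anticomm fg) xh.
  have ys := homogeneous_low (ap_pair_comm fg) (ap_pair_anticomm fg) yh.
  clear la ma xh yh IHx IHy l1 m1; subst l m n.
  have [c ->] : exists c, x = c *: (if a is 0%N then f else g) := xs.
  have [d ->] : exists d, y = d *: (if a' is 0%N then f else g) := ys.
  rewrite compZr; apply: arity3_formZ.
  rewrite compZl; apply: arity3_formZ.
  rewrite (eq_irrelevance e erefl); exact: arity3_form_binary.
- by move=> a b n s x _; apply: arity3_form_act.
- by move=> a b n _; apply: arity3_form0.
- by move=> a b n c x y _ xs _ ys; apply: arity3_formZD.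
Qed.

End Arity3.

(** * The associator and the Leibniz defect in arity four *)

(** [(a1 a2) a3 - a1 (a2 a3)]. *)
Definition associator (k : fieldType) (Q : operad k) (f : Q 2%N) : Q 3%N :=
  f o1 f - f o2 f.

(** [{a1 a2, a3} - ({a1, a3} a2 + a1 {a2, a3})]. *)
Definition leibnizator (k : fieldType) (Q : operad k) (f g : Q 2%N) : Q 3%N :=
  g o1 f - (act swap23 (f o1 g) + f o2 g).

(** The permutations of four inputs that put in order the inputs of [x (a, {b, d}, c)]
    and of [x ({a, d}, b, c)]: the transposition [2 <-> 3] and the cycle
    [1 -> 3 -> 2 -> 1]. *)
Definition swap34 : 'S_4 := tperm ('i4_2) ('i4_3).
Definition shift234 : 'S_4 := (tperm ('i4_1) ('i4_2) * swap34)%g.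

Section Arity4.
Variables (k : fieldType) (Q : operad k) (f g : Q 2%N).

(** The expansion of [{(ab)c, d}]: the sum of [({a, d}b)c], [(a{b, d})c],
    [(ab){c, d}], [L (ab, c, d)] and [L (a, b, d) c]. *)
Lemma bracket_comp1 : g \o3_ord0 (f o1 f) =
  act shift234 ((f o1 f) \o2_('i3_0) g) + act swap34 ((f o1 f) \o2_('i3_1) g) +
  (f o1 f) \o2_('i3_2) g +
  leibnizator f g \o2_('i3_0) f + act swap34 (f \o3_ord0 (leibnizator f g)) :> Q 4%N.
Proof.
have gE : g o1 f = leibnizator f g + (act swap23 (f o1 g) + f o2 g) :> Q 3%N.
  by rewrite subrK.
move: (leibnizator f g) gE => Lz gE.
rewrite -(comp_seq (erefl 4%N : 2 + 2 = 4)%N (erefl 5%N : 3 + 2 = 5)%N _ _ _ _ _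
  (h := 'i3_0)) //.
rewrite gE !compDl.
have b1 : block_perm ('i3_0) swap23 (1%g : 'S_2) swap34.
  by apply: block_permP => -[|[|[|j]]] //; rewrite ?perm_natE.
have := comp_act (erefl 5%N : 3 + 2 = 5)%N (f o1 g) f b1.
rewrite act1 (_ : swap23 _ = 'i3_0) => [->|]; last by rewrite tpermD.
rewrite (comp_seq (erefl 4%N : 2 + 2 = 4)%N (erefl 5%N : 3 + 2 = 5)%N
  (erefl 4%N : 2 + 2 = 4)%N (erefl 5%N : 2 + 3 = 5)%N f g f
  (i := ord0) (j := ord0) (h := 'i3_0)) //.
rewrite gE !compDr !actD.
have b2 : block_perm ord0 (1%g : 'S_2) swap23 (tperm ('i4_1) ('i4_2)).
  by apply: block_permP => -[|[|[|j]]] //; rewrite ?perm_natE.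
have := comp_act (erefl 5%N : 2 + 3 = 5)%N f (f o1 g) b2.
rewrite act1 perm1 => ->; rewrite -actM -/shift234.
rewrite -(comp_seq (erefl 4%N : 2 + 2 = 4)%N (erefl 5%N : 3 + 2 = 5)%N 
  (erefl 4%N : 2 + 2 = 4)%N (erefl 5%N : 2 + 3 = 5)%N f f g
  (i := ord0) (j := ord0) (h := 'i3_0)) //.
rewrite -(comp_seq (erefl 4%N : 2 + 2 = 4)%N (erefl 5%N : 3 + 2 = 5)%N 
  (erefl 4%N : 2 + 2 = 4)%N (erefl 5%N : 2 + 3 = 5)%N f f g
  (i := ord0) (j := ord_max) (h := 'i3_1)) //.
rewrite -(comp_par (erefl 4%N : 2 + 2 = 4)%N (erefl 5%N : 3 + 2 = 5)%N 
  (erefl 4%N : 2 + 2 = 4)%N (erefl 5%N : 3 + 2 = 5)%N f f g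
  (i := ord0) (j := ord_max) (h := 'i3_2) (g := 'i3_0)) //.
by rewrite [act swap34 _ + _]addrC [X in _ + X]addrAC addrA [in LHS](addrC (comp _ Lz _ _)).
Qed.

(** The expansion of [{a(bc), d}]: the sum of [{a, d}(bc)], [a({b, d}c)],
    [a(b{c, d})], [L (a, bc, d)] and [a L (b, c, d)]. *)
Lemma bracket_comp2 : g \o3_ord0 (f o2 f) =
  act shift234 ((f o2 f) \o2_('i3_0) g) + act swap34 ((f o2 f) \o2_('i3_1) g) +
  (f o2 f) \o2_('i3_2) g +
  leibnizator f g \o2_('i3_1) f + f \o3_ord_max (leibnizator f g) :> Q 4%N.
Proof.
have gE : g o1 f = leibnizator f g + (act swap23 (f o1 g) + f o2 g) :> Q 3%N.
  by rewrite subrK.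
move: (leibnizator f g) gE => Lz gE.
rewrite -(comp_seq (erefl 4%N : 2 + 2 = 4)%N (erefl 5%N : 3 + 2 = 5)%N _ _ _ _ _
  (h := 'i3_1)) //.
rewrite gE !compDl.
rewrite (comp_seq (erefl 4%N : 2 + 2 = 4)%N (erefl 5%N : 3 + 2 = 5)%N
  (erefl 4%N : 2 + 2 = 4)%N (erefl 5%N : 2 + 3 = 5)%N f g f
  (i := ord_max) (j := ord0) (h := 'i3_1)) //.
rewrite gE !compDr.
have b1 : block_perm ord_max (1%g : 'S_2) swap23 swap34.
  by apply: block_permP => -[|[|[|j]]] //; rewrite ?perm_natE.
have := comp_act (erefl 5%N : 2 + 3 = 5)%N f (f o1 g) b1.
rewrite act1 perm1 => ->.
rewrite -(comp_seq (erefl 4%N : 2 + 2 = 4)%N (erefl 5%N : 3 + 2 = 5)%N 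
  (erefl 4%N : 2 + 2 = 4)%N (erefl 5%N : 2 + 3 = 5)%N f f g
  (i := ord_max) (j := ord0) (h := 'i3_1)) //.
rewrite -(comp_seq (erefl 4%N : 2 + 2 = 4)%N (erefl 5%N : 3 + 2 = 5)%N 
  (erefl 4%N : 2 + 2 = 4)%N (erefl 5%N : 2 + 3 = 5)%N f f g
  (i := ord_max) (j := ord_max) (h := 'i3_2)) //.
have b2 : block_perm ('i3_2) swap23 (1%g : 'S_2) shift234.
  by apply: block_permP => -[|[|[|j]]] //; rewrite ?perm_natE.
have := comp_act (erefl 5%N : 3 + 2 = 5)%N (f o1 g) f b2.
rewrite act1 tpermR => ->.
rewrite (comp_par (erefl 4%N : 2 + 2 = 4)%N (erefl 5%N : 3 + 2 = 5)%N 
  (erefl 4%N : 2 + 2 = 4)%N (erefl 5%N : 3 + 2 = 5)%N f g f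
  (i := ord0) (j := ord_max) (h := 'i3_2) (g := 'i3_0)) //.
by rewrite [comp _ f _ Lz + _]addrC [LHS]addrC !addrA addrAC.
Qed.

(** [{x (a, b, c), d} - (x ({a, d}, b, c) + x (a, {b, d}, c) + x (a, b, {c, d}))]: the
    failure of the bracket with [d] to be a derivation for the operation [x]. *)
Definition derivation_defect (x : Q 3%N) : Q 4%N := g \o3_ord0 x -
  (act shift234 (x \o2_('i3_0) g) + act swap34 (x \o2_('i3_1) g) + x \o2_('i3_2) g).

(** [x (ab, c, d) - x (a, bc, d) + x (a, b, d) c - a x (b, c, d)]. *)
Definition leibniz_boundary (x : Q 3%N) : Q 4%N :=
  x \o2_('i3_0) f - x \o2_('i3_1) f + act swap34 (f \o3_ord0 x) - f \o3_ord_max x.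

Lemma derivation_defect_associator :
  derivation_defect (associator f) = leibniz_boundary (leibnizator f g).
Proof.
apply/eqP; rewrite subr_eq addrC; apply/eqP.
rewrite /leibniz_boundary /associator compBr bracket_comp1 bracket_comp2 !compBl !actB.
by rewrite !opprD [LHS]addrACA [X in X + _]addrACA [X in X + _ + _]addrACA
  [X in X + _ + _ + _]addrACA !addrA.
Qed.

End Arity4.

(** * Test computations in almost Poisson algebras *)

(** The table of brackets of 14 variables: [(i, j, h)] stands for [{z_i, z_j} = z_h],
    and the brackets that it does not determine by antisymmetry are 0.  Thus
    [z_5 = {{z_0, z_1}, z_2}], [z_6 = {z_5, z_3}] and [z_7 = {{z_0, z_1}, z_3}], while
    [z_12 = {z_8, z_9}] and [z_13 = {z_10, z_11}] have zero bracket with all the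
    variables. *)
Definition test_triples : seq (nat * nat * nat) :=
  [:: (0, 1, 4); (4, 2, 5); (5, 3, 6); (4, 3, 7); (8, 9, 12); (10, 11, 13)]%N.

(** Evaluation, on the variables [z], of ternary operations of a commutative algebra
    with a biderivation given on [z] by the above table. *)
Section Tests.
Variables (k : fieldType) (A : comAlgType k) (br : A -> A -> A) (z : nat -> A).
Hypotheses (brC : forall a b, br a b = - br b a)
  (brZl : forall c a b, br (c *: a) b = c *: br a b)
  (brMl : forall a b c, br (a * b) c = br a c * b + a * br b c)
  (br_table : forall i j, (i < 14)%N -> (j < 14)%N -> br (z i) (z j) =
    foldr (fun (t : nat * nat * nat) s =>
      (if (t.1.1 == i) && (t.1.2 == j) then z t.2
       else if (t.1.1 == j) && (t.1.2 == i) then - z t.2 else 0) + s) 0 test_triples).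

Let br0l a : br 0 a = 0. Proof. by rewrite -(scale0r 0) brZl !scale0r. Qed.
Let br0r a : br a 0 = 0. Proof. by rewrite brC br0l oppr0. Qed.
Let brNl a b : br (- a) b = - br a b. Proof. by rewrite -scaleN1r brZl scaleN1r. Qed.
Let brMr a b c : br c (a * b) = br c a * b + a * br c b.
Proof. by rewrite brC brMl (brC c a) (brC c b) opprD mulNr mulrN. Qed.

Let brE := (mul0r, mulr0, addr0, add0r, oppr0, scaler0, subr0, sub0r,
  br0l, br0r, brNl, brZl, brMl, brMr).

Ltac evaluate := do !(rewrite ?brE; rewrite ?br_table //=).

Section Double.
Variables (p q r : k) (L : A -> A -> A -> A).
Hypothesis LE : forall a b c,
  L a b c = p *: br (br a b) c + q *: br (br b c) a + r *: br (br c a) b.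

(** Symmetry of [L] in its first two arguments equates the coefficients [p] and [- p],
    and [q] and [- r], of [z_5 = {{z_0, z_1}, z_2}] in suitable values of [L]. *)
Lemma swap_test : (forall a b c, L a b c = L b a c) ->
  (p *+ 2) *: z 5 = 0 /\ (q + r) *: z 5 = 0.
Proof.
move=> LC; split.
  have := LC (z 0) (z 1) (z 2); rewrite !LE; evaluate.
  by move/eqP; rewrite scalerN -subr_eq0 opprK -scalerDl => /eqP.
have := LC (z 2) (z 0) (z 1); rewrite !LE; evaluate.
by move/eqP; rewrite scalerN -subr_eq0 opprK -scalerDl => /eqP.
Qed.

Variables (p' q' r' : k) (Y : A -> A -> A -> A).
Hypothesis YE : forall a b c,
  Y a b c = p' *: (br a b * c) + q' *: (br b c * a) + r' *: (br c a * b).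

(** Both terms of [Y] that involve [{z_8, z_9}] cancel on the left, and on the right
    only [L (z_8, z_9 z_10, z_11)] survives. *)
Lemma leibniz_test c d : p = 0 ->
  (forall a b e f, c *: (br (Y a b e) f - (Y (br a f) b e + Y a (br b f) e + Y a b (br e f))) =
     d *: (L (a * b) e f - L a (b * e) f + L a b f * e - a * L b e f)) ->
  (d * q) *: (z 12 * z 13) = 0.
Proof.
move=> p0 /(_ (z 8) (z 9) (z 10) (z 11)).
rewrite !LE !YE p0; evaluate.
by rewrite subrr scaler0 scale0r add0r mulNr (scalerN q) opprK scalerA => <-.
Qed.

(** For the three rotations of [z_0, z_1, z_2] as first arguments, the monomial
    [z_6 = {{{z_0, z_1}, z_2}, z_3}] occurs in [{L (a, b, e), f}] only, with the
    coefficients [p], [q] and [r]. *)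
Lemma double_test :
  (forall a b e f, br (L a b e) f - (L (br a f) b e + L a (br b f) e + L a b (br e f)) = 0) ->
  [/\ p *: z 6 = 0, q *: z 6 = 0 & r *: z 6 = 0].
Proof.
move=> LD; split.
- by have := LD (z 0) (z 1) (z 2) (z 3); rewrite !LE; evaluate.
- by have := LD (z 2) (z 0) (z 1) (z 3); rewrite !LE; evaluate.
- by have := LD (z 1) (z 2) (z 0) (z 3); rewrite !LE; evaluate.
Qed.

End Double.

(** Likewise for the monomial [z_7 z_2 = {{z_0, z_1}, z_3} z_2]. *)
Lemma product_test (p q r : k) (Y : A -> A -> A -> A) :
  (forall a b c, Y a b c = p *: (br a b * c) + q *: (br b c * a) + r *: (br c a * b)) ->
  (forall a b e f, br (Y a b e) f - (Y (br a f) b e + Y a (br b f) e + Y a b (br e f)) = 0) ->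
  [/\ p *: (z 7 * z 2) = 0, q *: (z 7 * z 2) = 0 & r *: (z 7 * z 2) = 0].
Proof.
move=> YE YD; split.
- by have := YD (z 0) (z 1) (z 2) (z 3); rewrite !YE; evaluate.
- by have := YD (z 2) (z 0) (z 1) (z 3); rewrite !YE; evaluate.
- by have := YD (z 1) (z 2) (z 0) (z 3); rewrite !YE; evaluate.
Qed.

End Tests.

(** * Faithfulness of the polynomial model *)

Section TestModel.
Variable k : fieldType.
Local Notation A := {mpoly k[14]}.

(** The representation on the polynomial ring in 14 variables whose bracket is given on
    the variables by the above table. *)
Definition test_model := @poly_model k 14
  [seq (inord t.1.1, inord t.1.2, inord t.2) | t <- test_triples].

Definition test_var (i : nat) : A := 'X_(inord i).
Definition test_bracket : A -> A -> A := poly_bracket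
  [seq (inord t.1.1, inord t.1.2, inord t.2) | t <- test_triples].

Lemma test_bracket_var i j : (i < 14)%N -> (j < 14)%N ->
  test_bracket (test_var i) (test_var j) = \sum_(t <- test_triples)
    (((t.1.1 == i) && (t.1.2 == j))%:R - ((t.1.1 == j) && (t.1.2 == i))%:R) * test_var t.2.
Proof.
have inordE a b : (a < 14)%N -> (b < 14)%N ->
    (inord a == inord b :> 'I_14) = (a == b).
  by move=> a14 b14; rewrite -val_eqE /= !inordK.
move=> i14 j14; rewrite /test_bracket poly_bracketX big_map.
rewrite !big_seq; apply: eq_bigr => t tT /=.
have /and3P[t1 t2 t3] : [&& (t.1.1 < 14), (t.1.2 < 14) & (t.2 < 14)]%N.
  have /allP := (isT : all (fun t => [&& t.1.1 < 14, t.1.2 < 14 & t.2 < 14]%N) test_triples).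
  by apply.
by rewrite !inordE.
Qed.

Lemma test_var_neq0 i : test_var i != 0.
Proof. by rewrite -msize_poly_eq0 /test_var msizeX. Qed.

(** The family of arguments listed in [s]. *)
Definition tup (s : seq A) : nat -> A := nth 0 s.

Let ap := almost_poisson k.

Lemma model_bb (x : ap 3%N) p q r a b c s :
  x = p *: (abra k o1 abra k) + q *: act rot3 (abra k o1 abra k)
      + r *: act (rot3 ^+ 2) (abra k o1 abra k) ->
  test_model 3 x (tup (a :: b :: c :: s)) = p *: test_bracket (test_bracket a b) c
   + q *: test_bracket (test_bracket b c) a + r *: test_bracket (test_bracket c a) b.
Proof.
move=> ->; rewrite !homD !homZ !hom_act !hom_comp ap_hom_bra !mfunD !mfunZ /=.
by rewrite /mcomp_fun /= /plug /= expgS expg1 !perm_natE.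
Qed.

Lemma model_mb (x : ap 3%N) p q r a b c s :
  x = p *: (aprod k o1 abra k) + q *: act rot3 (aprod k o1 abra k)
      + r *: act (rot3 ^+ 2) (aprod k o1 abra k) ->
  test_model 3 x (tup (a :: b :: c :: s)) = p *: (test_bracket a b * c)
   + q *: (test_bracket b c * a) + r *: (test_bracket c a * b).
Proof.
move=> ->; rewrite !homD !homZ !hom_act !hom_comp ap_hom_bra ap_hom_prod !mfunD !mfunZ /=.
by rewrite /mcomp_fun /= /plug /= expgS expg1 !perm_natE.
Qed.

Lemma model_swap (x : ap 3%N) a b c :
  test_model 3 (act swap12_3 x) (tup [:: a; b; c]) = test_model 3 x (tup [:: b; a; c]).
Proof.
rewrite hom_act /=; apply: mfun_local => -[|[|[|i]]] //= _; by rewrite perm_natE.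
Qed.

Lemma model_derivation_defect (x : ap 3%N) a b c d :
  test_model 4 (derivation_defect (abra k) x) (tup [:: a; b; c; d]) =
  test_bracket (test_model 3 x (tup [:: a; b; c])) d -
  (test_model 3 x (tup [:: test_bracket a d; b; c]) +
   test_model 3 x (tup [:: a; test_bracket b d; c]) +
   test_model 3 x (tup [:: a; b; test_bracket c d])).
Proof.
rewrite /derivation_defect homB !homD !hom_act !hom_comp ap_hom_bra.
rewrite [LHS]mfunD mfunN !mfunD /= /mcomp_fun /=.
congr (_ - (_ + _ + _)); first congr (test_bracket _ _);
  by apply: mfun_local => -[|[|[|i]]] // _; rewrite /= /plug /= ?perm_natE.
Qed.

Lemma model_leibniz_boundary (x : ap 3%N) a b c d :
  test_model 4 (leibniz_boundary (aprod k) x) (tup [:: a; b; c; d]) =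
  test_model 3 x (tup [:: a * b; c; d]) - test_model 3 x (tup [:: a; b * c; d])
  + test_model 3 x (tup [:: a; b; d]) * c - a * test_model 3 x (tup [:: b; c; d]).
Proof.
rewrite /leibniz_boundary homB homD homB !hom_act !hom_comp ap_hom_prod.
rewrite [LHS]mfunD mfunN !mfunD mfunN /= /mcomp_fun /=.
congr (_ - _ + _ * _ - _ * _); rewrite /plug /= ?perm_natE //;
  by apply: mfun_local => -[|[|[|i]]] // _; rewrite /= /plug /= ?perm_natE.
Qed.

Lemma test_table i j : (i < 14)%N -> (j < 14)%N ->
  test_bracket (test_var i) (test_var j) =
  foldr (fun (t : nat * nat * nat) s =>
    (if (t.1.1 == i) && (t.1.2 == j) then test_var t.2
     else if (t.1.1 == j) && (t.1.2 == i) then - test_var t.2 else 0) + s) 0 test_triples.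
Proof.
move=> i14 j14; rewrite test_bracket_var // /test_triples !big_cons big_nil /=.
have coefE (a b : nat) (y : A) : a != b ->
    (((a == i) && (b == j))%:R - ((a == j) && (b == i))%:R) * y =
    if (a == i) && (b == j) then y else if (a == j) && (b == i) then - y else 0.
  move=> ab; case: (boolP ((a == i) && (b == j))) => [/andP[/eqP <- /eqP <-]|_].
    by rewrite (negbTE ab) subr0 mul1r.
  by case: ifP => _; rewrite sub0r ?mulN1r // oppr0 mul0r.
by rewrite !coefE.
Qed.

Lemma test_bracketC y z : test_bracket y z = - test_bracket z y.
Proof. exact: poly_bracketC. Qed.
Lemma test_bracketZl c y z : test_bracket (c *: y) z = c *: test_bracket y z.
Proof. exact: poly_bracketZl. Qed.
Lemma test_bracketMl y z t :
  test_bracket (y * z) t = test_bracket y t * z + y * test_bracket z t.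
Proof. exact: poly_bracketMl. Qed.

Lemma scale_test_eq0 (y : A) c : y != 0 -> c *: y = 0 -> c = 0.
Proof. by move=> y0 /eqP; rewrite scaler_eq0 (negbTE y0) orbF => /eqP. Qed.

Let fun3 (x : ap 3%N) a b c : A := test_model 3 x (tup [:: a; b; c]).

(** The degree 2 part of the identity relating the associator to the Leibniz defect
    forces the symbol [x] of the latter to vanish, whatever the symbol [y] of the
    former. *)
Lemma leibniz_symbol_eq0 (x y : ap 3%N) c d : (2%:R != 0 :> k) -> d != 0 ->
  rot_span (abra k o1 abra k) x -> rot_span (aprod k o1 abra k) y ->
  act swap12_3 x = x ->
  c *: derivation_defect (abra k) y = d *: leibniz_boundary (aprod k) x -> x = 0.
Proof.
move=> char2 d0 [p [q [r xE]]] [p' [q' [r' yE]]] xC xy.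
have X a b e := @model_bb x p q r a b e [::] xE.
have Y a b e := @model_mb y p' q' r' a b e [::] yE.
have XC a b e : fun3 x a b e = fun3 x b a e by rewrite /fun3 -model_swap xC.
have [/scale_test_eq0 p0 /scale_test_eq0 qr] :=
  swap_test test_bracketZl test_table X XC.
have {}p0 : p = 0.
  have /eqP := p0 (test_var_neq0 5).
  by rewrite -mulr_natr mulf_eq0 (negbTE char2) orbF => /eqP.
have /scale_test_eq0 q0 : (d * q) *: (test_var 12 * test_var 13) = 0.
  apply: (leibniz_test test_bracketC test_bracketZl test_bracketMl test_table X Y
    (c := c) p0) => a b e f.
  have := congr1 (fun z => test_model 4 z (tup [:: a; b; e; f])) xy.
  by rewrite !homZ !mfunZ model_derivation_defect model_leibniz_boundary.
have {}q0 : q = 0.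
  have /eqP : d * q = 0 by apply: q0; rewrite mulf_neq0 // test_var_neq0.
  by rewrite mulf_eq0 (negbTE d0) => /eqP.
have r0 : r = 0 by have := qr (test_var_neq0 5); rewrite q0 add0r.
by rewrite xE p0 q0 r0 !scale0r !addr0.
Qed.

(** The bracket with a generic element is a derivation for no nonzero combination of the
    [{x, y}z]. *)
Lemma product_symbol_eq0 (x : ap 3%N) :
  rot_span (aprod k o1 abra k) x -> derivation_defect (abra k) x = 0 -> x = 0.
Proof.
move=> [p [q [r xE]]] x0; have X a b e := @model_mb x p q r a b e [::] xE.
have z0 : test_var 7 * test_var 2 != 0 by rewrite mulf_neq0 // test_var_neq0.
have [|p0 q0 r0] := product_test test_bracketC test_bracketZl test_bracketMl test_table X.
  move=> a b e f; rewrite -[LHS]model_derivation_defect x0 hom0; exact: mfun0.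
by rewrite xE (scale_test_eq0 z0 p0) (scale_test_eq0 z0 q0) (scale_test_eq0 z0 r0)
  !scale0r !addr0.
Qed.

(** The bracket with a generic element is a derivation for no nonzero combination of the
    [{{x, y}, z}]. *)
Lemma double_bracket_symbol_eq0 (x : ap 3%N) :
  rot_span (abra k o1 abra k) x -> derivation_defect (abra k) x = 0 -> x = 0.
Proof.
move=> [p [q [r xE]]] x0; have X a b e := @model_bb x p q r a b e [::] xE.
have z0 := test_var_neq0 6.
have [|p0 q0 r0] := double_test test_bracketC test_bracketZl test_table X.
  move=> a b e f; rewrite -[LHS]model_derivation_defect x0 hom0; exact: mfun0.
by rewrite xE (scale_test_eq0 z0 p0) (scale_test_eq0 z0 q0) (scale_test_eq0 z0 r0)
  !scale0r !addr0.
Qed.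

Lemma ap_independent p q : p *: aprod k + q *: abra k = 0 -> p = 0 /\ q = 0.
Proof.
move=> pq; have {}pq a b : p *: (a * b) + q *: test_bracket a b = 0.
  have := congr1 (fun z => test_model 2 z (tup [:: a; b])) pq.
  by rewrite hom_linear homZ ap_hom_bra ap_hom_prod hom0.
have p0 : p = 0.
  have := pq (test_var 0) (test_var 0); rewrite test_table //= !addr0 scaler0 addr0.
  by apply: scale_test_eq0; rewrite mulf_neq0 // test_var_neq0.
split=> //; have := pq (test_var 0) (test_var 1).
rewrite p0 scale0r add0r test_table //= !addr0; apply: scale_test_eq0.
exact: test_var_neq0.
Qed.

End TestModel.

(** * Operads generated by two operations *)

Lemma almost_poisson_generated (k : fieldType) : generates (aprod k) (abra k).
Proof.
move=> S Sp Sb m x.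
have S_term n (t : operad_term k ap_generator n) :
    S n (operad_quotient_pi (ideal_gen (@ap_relation k)) (free_pi t)).
  elim: t => {n}.
  - by move=> n [].
  - move=> n; rewrite operad_quotient_pi_eq0; first exact: subspace0.
    exact: subspace0.
  - move=> n t St u Su.
    have -> : free_pi (term_add t u) = free_pi t + free_pi u :> free_operad k ap_generator n.
      by apply: free_pi_eq => Q g /=; rewrite !term_eval_repr.
    by rewrite operad_quotient_piD; apply: subspaceD.
  - move=> n c t St.
    have -> : free_pi (term_scale c t) = c *: free_pi t :> free_operad k ap_generator n.
      by apply: free_pi_eq => Q g /=; rewrite !term_eval_repr.
    rewrite /operad_quotient_pi linearZ; exact: subspaceZ.
  - exact: suboperad_id.
  - move=> n s t St.
    have -> : free_pi (term_act s t) = act s (free_pi t : free_operad k ap_generator n).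
      by apply: free_pi_eq => Q g /=; rewrite !term_eval_repr.
    by rewrite -operad_quotient_pi_act; apply: subseq_act.
  - move=> l m' n e t St i u Su.
    have -> : free_pi (term_comp e t i u) = comp e (free_pi t : free_operad k ap_generator l)
        i (free_pi u : free_operad k ap_generator m').
      by apply: free_pi_eq => Q g /=; rewrite !term_eval_repr.
    by rewrite -operad_quotient_pi_comp; apply: suboperad_comp.
elim/operad_quotient_ind: x => x; rewrite -[x]reprK; exact: S_term.
Qed.

Section Generated.
Variables (k : fieldType) (Q : operad k) (f g : Q 2%N).
Hypotheses (fg_gen : generates f g) (fC : act swap12 f = f) (gC : act swap12 g = - g).

Let F := ideal_filtration (ideal_gen1 g).

Lemma arity2_span (x : Q 2%N) : exists p q, x = p *: f + q *: g.
Proof.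
pose U (y : Q 2%N) := exists p q, y = p *: f + q *: g.
have U0 : U 0 by exists 0, 0; rewrite !scale0r addr0.
have UZD c y z : U y -> U z -> U (c *: y + z).
  move=> [p [q ->]] [p' [q' ->]]; exists (c * p + p'), (c * q + q').
  by rewrite scalerDr !scalerA addrACA -!scalerDl.
apply: (degree_ge0 fg_gen x (W := Subspace U0 UZD)) => y [a [b [_ yh]]].
have [c ->] : exists c, y = c *: (if a is 0%N then f else g) := homogeneous_low fC gC yh.
case: a {yh} => [|a]; first by exists c, 0; rewrite scale0r addr0.
by exists 0, c; rewrite scale0r add0r.
Qed.

Lemma power1_arity2 (x : Q 2%N) : F 1%N 2%N x -> exists c, x = c *: g.
Proof.
pose U (y : Q 2%N) := exists c, y = c *: g.
have U0 : U 0 by exists 0; rewrite scale0r.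
have UZD c y z : U y -> U z -> U (c *: y + z).
  by move=> [p ->] [p' ->]; exists (c * p + p'); rewrite scalerDl !scalerA.
move=> /(power_degree_ge fg_gen) /(_ (Subspace U0 UZD)); apply=> y [a [b [a1 yh]]].
have := homogeneous_low fC gC yh; case: a a1 {yh} => //.
Qed.

Lemma homogeneous_decomposition n (x : Q n) : exists y : nat -> Q n,
  (forall a, (a < n)%N -> homogeneous f g a (n.-1 - a) (y a)) /\ x = \sum_(a < n) y a.
Proof.
pose U (x : Q n) := exists y : nat -> Q n,
  (forall a, (a < n)%N -> homogeneous f g a (n.-1 - a) (y a)) /\ x = \sum_(a < n) y a.
have U0 : U 0.
  exists (fun=> 0); split; last by rewrite big1.
  move=> a an; apply: homogeneous0; lia.
have UZD c y z : U y -> U z -> U (c *: y + z).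
  move=> [u [uh ->]] [v [vh ->]]; exists (fun a => c *: u a + v a); split.
    by move=> a an; apply: homogeneousZD; [apply: uh|apply: vh].
  by rewrite scaler_sumr -big_split.
apply: (degree_ge0 fg_gen x (W := Subspace U0 UZD)) => y [a [b [_ yh]]].
have nE := homogeneous_arity yh; have an : (a < n)%N by lia.
exists (fun c => if c == a then y else 0); split=> [c cn|].
  case: eqP => [->|_]; last by apply: homogeneous0; lia.
  by rewrite (_ : n.-1 - a = b)%N //; lia.
rewrite (bigD1 (Ordinal an)) //= eqxx big1 ?addr0 // => i.
by rewrite -val_eqE /= => /negbTE ->.
Qed.

End Generated.

(** When the product is commutative, the Leibniz defect is symmetric in its first two
    inputs. *)
Lemma leibnizator_swap (k : fieldType) (Q : operad k) (f g : Q 2%N) :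
  act swap12 f = f -> act swap12_3 (leibnizator f g) = leibnizator f g.
Proof.
move=> fC; rewrite /leibnizator actB actD -comp_o1_swap fC.
have -> : f o2 g = act rot3 (f o1 g) :> Q 3%N by rewrite -comp_swap_o2 fC.
rewrite -!actM [X in _ - X]addrC; congr (_ - (act _ _ + act _ _)).
  by apply: perm_nat_eq => -[|[|[|j]]] // _; rewrite !perm_natE.
by apply: perm_nat_eq => -[|[|[|j]]] // _; rewrite !perm_natE.
Qed.

Lemma hom_bijective_isomorphic (k : fieldType) (P Q : operad k) (h : operad_hom Q P) :
  (forall n (x : Q n), h n x = 0 -> x = 0) ->
  (forall n (y : P n), exists x, h n x = y) -> isomorphic P Q.
Proof.
move=> h_inj0 h_surj.
have h_inj n (x y : Q n) : h n x = h n y -> x = y.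
  by move=> xy; apply/eqP; rewrite -subr_eq0; apply/eqP/h_inj0; rewrite homB xy subrr.
pose inv n (y : P n) : Q n := sval (cid (h_surj n y)).
have invK n (y : P n) : h n (inv n y) = y by rewrite /inv; case: cid.
constructor; exists inv.
- move=> n; exists (h n) => y; first exact: invK.
  by apply: h_inj; rewrite invK.
- by move=> n c x y; apply: h_inj; rewrite homD homZ !invK.
- by move=> n s x; apply: h_inj; rewrite hom_act !invK.
- by apply: h_inj; rewrite invK hom_id.
- by move=> l m n e x i y; apply: h_inj; rewrite hom_comp !invK.
Qed.

(** * Rigidity *)

Section Rigidity.
Variables (k : fieldType) (P : operad k) (f g : P 2%N).
Hypotheses (char2 : 2%:R != 0 :> k) (fg_gen : generates f g)
  (fC : act swap12 f = f) (gC : act swap12 g = - g).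

Let F := ideal_filtration (ideal_gen1 g).
Variable phi : operad_iso (gr F) (almost_poisson k).

Local Notation ap := (almost_poisson k).
Local Notation pr := (aprod k).
Local Notation br := (abra k).

Let phi_hom : operad_hom (gr F) ap :=
  OperadHom (@iso_linear _ _ _ phi) (@iso_act _ _ _ phi) (iso_id phi) (@iso_comp _ _ _ phi).

(** The leading term of [x] in degree [a], seen in the almost Poisson operad. *)
Definition symbol a n (x : P n) : ap n := phi_hom n (leading F a x).

Let F0 n (x : P n) : F 0%N n x. Proof. exact: filt0. Qed.
Let Fg : F 1%N 2%N g.
Proof. exact: (homogeneous_power (homogeneous_right g g)). Qed.

Lemma symbolP a n c (x y : P n) : F a n x -> F a n y ->
  symbol a (c *: x + y) = c *: symbol a x + symbol a y.
Proof. by move=> Fx Fy; rewrite /symbol leadingP // hom_linear. Qed.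

Lemma symbol_eq0 a n (x : P n) : F a n x -> symbol a x = 0 -> F a.+1 n x.
Proof.
move=> Fx x0; apply/(leading_eq0 Fx).
have [inv invK _] := iso_bij phi n.
rewrite -(invK (leading F a x)) -(invK 0); congr inv.
by rewrite [LHS]x0 -[LHS](hom0 phi_hom).
Qed.

Lemma symbol_filtS a n (x : P n) : F a.+1 n x -> symbol a x = 0.
Proof.
move=> Fx; rewrite /symbol (_ : leading F a x = 0) ?hom0 //.
by apply/leading_eq0 => //; apply: filtS.
Qed.

Lemma symbol0 a n : symbol a (0 : P n) = 0.
Proof. by apply: symbol_filtS; apply: subspace0. Qed.

Lemma symbolZ a n c (x : P n) : F a n x -> symbol a (c *: x) = c *: symbol a x.
Proof.
by move=> Fx; rewrite -[c *: x]addr0 symbolP ?symbol0 ?addr0 //; apply: subspace0.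
Qed.

Lemma symbolD a n (x y : P n) : F a n x -> F a n y ->
  symbol a (x + y) = symbol a x + symbol a y.
Proof. by move=> Fx Fy; rewrite -[x]scale1r symbolP // !scale1r. Qed.

Lemma symbolB a n (x y : P n) : F a n x -> F a n y ->
  symbol a (x - y) = symbol a x - symbol a y.
Proof.
by move=> Fx Fy; rewrite addrC -scaleN1r symbolP // scaleN1r addrC.
Qed.

Lemma symbol_id : symbol 0 oid = oid.
Proof. by rewrite /symbol leading_id hom_id. Qed.

Lemma symbol_act a n (s : 'S_n) (x : P n) : F a n x ->
  symbol a (act s x) = act s (symbol a x).
Proof. by move=> Fx; rewrite /symbol leading_act // hom_act. Qed.

Lemma symbol_comp a b ab l m n (e : (l + m = n.+1)%N) (x : P l) (i : 'I_l) (y : P m) :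
  (a + b)%N = ab -> F a l x -> F b m y ->
  symbol ab (comp e x i y) = comp e (symbol a x) i (symbol b y).
Proof. by move=> <- Fx Fy; rewrite /symbol leading_comp // hom_comp. Qed.

Let ap_fC := ap_pair_comm (almost_poisson_pair k).
Let ap_gC := ap_pair_anticomm (almost_poisson_pair k).
Let ap_gen := @almost_poisson_generated k.

Let two_eq0 (c : k) : c = - c -> c = 0.
Proof.
move/eqP; rewrite -subr_eq0 opprK -mulr2n -mulr_natr mulf_eq0 (negbTE char2) orbF.
by move/eqP.
Qed.

Lemma symbol_prod : exists c, symbol 0 f = c *: pr.
Proof.
have [p [q fE]] := arity2_span ap_gen ap_fC ap_gC (symbol 0 f); exists p.
have : act swap12 (symbol 0 f) = symbol 0 f by rewrite -symbol_act // fC.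
rewrite fE actD !actZ ap_fC ap_gC => /addrI /eqP.
rewrite scalerN eq_sym -subr_eq0 opprK -scalerDl => /eqP qq.
have [_ q0] : 0%R = 0 :> k /\ q + q = 0.
  by apply: ap_independent; rewrite scale0r add0r.
by rewrite (two_eq0 (c := q)) ?scale0r ?addr0 //; apply/eqP; rewrite -addr_eq0 q0.
Qed.

Lemma symbol_bra : exists d, symbol 1 g = d *: br.
Proof.
have [p [q gE]] := arity2_span ap_gen ap_fC ap_gC (symbol 1 g); exists q.
have : act swap12 (symbol 1 g) = - symbol 1 g.
  by rewrite -symbol_act // gC -!scaleN1r symbolZ.
rewrite gE actD !actZ ap_fC ap_gC opprD scalerN => /addIr /eqP.
rewrite -subr_eq0 opprK -scalerDl => /eqP pp.
have [p0 _] : p + p = 0 /\ 0%R = 0 :> k.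
  by apply: ap_independent; rewrite scale0r addr0.
by rewrite (two_eq0 (c := p)) ?scale0r ?add0r //; apply/eqP; rewrite -addr_eq0 p0.
Qed.

(** In arity 2 only the degrees 0 and 1 of the associated graded operad are nonzero. *)
Lemma symbol_arity2_surj (y : ap 2%N) : exists x z : P 2%N,
  F 1%N 2%N z /\ y = symbol 0 x + symbol 1 z.
Proof.
have [inv _ phiK] := iso_bij phi 2; rewrite -(phiK y); move: (inv y) => w.
have [wF wE] := lifts_reprs w.
exists (reprs w 0), (reprs w 1); split; first exact: wF.
rewrite /symbol -homD; congr (phi _); apply: graded_eq => a.
have [_ x0] := lifts_leading (wF 0%N); have [_ x1] := lifts_leading (wF 1%N).
rewrite [RHS]/(component (leading F 0 _) a + component (leading F 1 _) a) x0 x1.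
rewrite wE; transitivity (\pi_(quotient (F a.+1 2)) (at_degree 0 (reprs w 0) a +
  at_degree 1 (reprs w 1) a)); last exact: linearD.
congr (\pi_(quotient _) _); rewrite /at_degree.
case: a => [|[|a]] /=; rewrite ?addr0 ?add0r //.
exact: (power_eq0 fg_gen _ (wF _)).
Qed.

Variables (c d : k).
Hypotheses (fE : symbol 0 f = c *: pr) (gE : symbol 1 g = d *: br).

Lemma symbol_scalars_neq0 : c != 0 /\ d != 0.
Proof.
have span y : exists p q : k, y = (p * c) *: pr + (q * d) *: br.
  have [x [z [/(power1_arity2 fg_gen fC gC)[e ->] ->]]] := symbol_arity2_surj y.
  have [p [q ->]] := arity2_span fg_gen fC gC x; exists p, e.
  rewrite symbolP // (symbol_filtS (x := q *: g)); last exact: subspaceZ.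
  by rewrite symbolZ // fE gE addr0 !scalerA.
have ind p q p' q' : p *: pr + q *: br = p' *: pr + q' *: br -> p = p' /\ q = q'.
  move=> /eqP; rewrite -subr_eq0 opprD addrACA -!scalerBl => /eqP/ap_independent.
  by move=> [/eqP + /eqP]; rewrite !subr_eq0 => /eqP -> /eqP ->.
split; apply/eqP => z0.
  have [p [q]] := span pr; rewrite z0 mulr0 -[pr in LHS]scale1r -[_ *: pr in LHS]addr0.
  by rewrite -(scale0r br) => /ind[/eqP]; rewrite oner_eq0.
have [p [q]] := span br; rewrite z0 mulr0 -[br in LHS]scale1r -[_ *: br in LHS]add0r.
by rewrite -(scale0r pr) => /ind[_ /eqP]; rewrite oner_eq0.
Qed.

Lemma homogeneous_symbol a b n (x : P n) :
  homogeneous f g a b x -> homogeneous pr br a b (symbol a x).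
Proof.
have hZ a' b' n' e (y : ap n') : homogeneous pr br a' b' y -> homogeneous pr br a' b' (e *: y).
  move=> yh; rewrite -[_ *: y]addr0; apply: homogeneousZD => //; apply: homogeneous0.
  by rewrite (homogeneous_arity yh).
have hF := @homogeneous_power _ _ f g.
elim=> {a b n x}.
- by rewrite symbol_id; apply: homogeneous_id.
- by rewrite fE; apply/hZ/homogeneous_left.
- by rewrite gE; apply/hZ/homogeneous_right.
- move=> a b a' b' l m n e x i y /hF Fx xh /hF Fy yh.
  by rewrite (symbol_comp e i erefl) //; apply: homogeneous_comp.
- by move=> a b n s x /hF Fx xh; rewrite symbol_act //; apply: homogeneous_act.
- by move=> a b n abn; rewrite symbol0; apply: homogeneous0.
- move=> a b n e x y /hF Fx xh /hF Fy yh.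
  by rewrite symbolP //; apply: homogeneousZD.
Qed.

Lemma symbol_arity3_form a n (x : P n) : F a n x -> arity3_form pr br a (symbol a x).
Proof.
pose U (y : P n) := F a n y /\ arity3_form pr br a (symbol a y).
have U0 : U 0 by split; [exact: subspace0|rewrite symbol0; exact: arity3_form0].
have UZD e y z : U y -> U z -> U (e *: y + z).
  move=> [Fy ys] [Fz zs]; split; first exact: subspaceZD.
  by rewrite symbolP //; apply: arity3_formZD.
move=> Fx; suff [] : Subspace U0 UZD x by [].
apply: (power_degree_ge fg_gen Fx) => y [a' [b [aa' yh]]].
have Fy := homogeneous_power yh.
split; first exact: filt_le aa' Fy.
move: aa'; rewrite leq_eqVlt => /orP[/eqP aa'|aa'].
  rewrite aa'; apply: (homogeneous_arity3 (almost_poisson_pair k)).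
  exact: homogeneous_symbol yh.
rewrite symbol_filtS; first exact: arity3_form0.
exact: filt_le aa' Fy.
Qed.

Let A := associator f.
Let L := leibnizator f g.

Let c0 : c != 0 := symbol_scalars_neq0.1.
Let d0 : d != 0 := symbol_scalars_neq0.2.

Let F_comp a b ab l m n (e : (l + m = n.+1)%N) (x : P l) (i : 'I_l) (y : P m) :
  (a + b)%N = ab -> F a l x -> F b m y -> F ab n (comp e x i y).
Proof. by move=> <-; apply: filt_comp. Qed.

Lemma associator_power1 : F 1%N 3%N A.
Proof.
apply: symbol_eq0 => //; rewrite symbolB // !(@symbol_comp 0 0) // fE.
rewrite !compZl !compZr (ap_pair_assoc (almost_poisson_pair k)).
by rewrite subrr.
Qed.

Lemma leibnizator_power2 : F 2%N 3%N L.
Proof.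
have Fgf i : F 1%N 3%N (comp (erefl 4%N : 2 + 2 = 4)%N g i f) by exact: (@F_comp 1 0).
have Ffg i : F 1%N 3%N (comp (erefl 4%N : 2 + 2 = 4)%N f i g) by exact: (@F_comp 0 1).
have Fr : F 1%N 3%N (act swap23 (f o1 g) + f o2 g).
  by apply: subspaceD => //; apply: subseq_act.
apply: symbol_eq0; first exact: subspaceB.
rewrite symbolB // symbolD //; last by apply: subseq_act.
rewrite symbol_act // (@symbol_comp 1 0) // !(@symbol_comp 0 1) // fE gE.
rewrite !compZl !compZr !actZ (ap_pair_leibniz (almost_poisson_pair k)).
by rewrite !scalerA [d * c]mulrC -scalerDr subrr.
Qed.

Lemma symbol_derivation_defect a (x : P 3%N) : F a 3%N x ->
  symbol a.+1 (derivation_defect g x) = d *: derivation_defect br (symbol a x).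
Proof.
move=> Fx.
have Fxg i : F a.+1 4%N (comp (erefl 5%N : 3 + 2 = 5)%N x i g).
  exact: (@F_comp a%N 1%N _ _ _ _ _ _ _ _ (addn1 _)).
have Fgx i : F a.+1 4%N (comp (erefl 5%N : 2 + 3 = 5)%N g i x).
  exact: (@F_comp 1%N a%N _ _ _ _ _ _ _ _ (add1n _)).
have xgE i : symbol a.+1 (comp (erefl 5%N : 3 + 2 = 5)%N x i g) =
    d *: comp (erefl 5%N : 3 + 2 = 5)%N (symbol a x) i br.
  by rewrite -compZr -gE (@symbol_comp a 1 _ _ _ _ _ _ _ _ (addn1 a)).
have gxE i : symbol a.+1 (comp (erefl 5%N : 2 + 3 = 5)%N g i x) =
    d *: comp (erefl 5%N : 2 + 3 = 5)%N br i (symbol a x).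
  by rewrite -compZl -gE (@symbol_comp 1 a _ _ _ _ _ _ _ _ (add1n a)).
have Fact (s : 'S_4) y : F a.+1 4%N y -> F a.+1 4%N (act s y) by apply: subseq_act.
have F0' : F a.+1 4%N (act shift234 (x \o2_('i3_0) g)) by apply: Fact.
have F1' : F a.+1 4%N (act swap34 (x \o2_('i3_1) g)) by apply: Fact.
have FD' := subspaceD F0' F1'.
have FD'' := subspaceD FD' (Fxg 'i3_2).
rewrite /derivation_defect symbolB // symbolD // symbolD // !symbol_act //.
by rewrite gxE !xgE !actZ -!scalerDr -scalerBr.
Qed.

Lemma symbol_leibniz_boundary a (x : P 3%N) : F a 3%N x ->
  symbol a (leibniz_boundary f x) = c *: leibniz_boundary pr (symbol a x).
Proof.
move=> Fx.
have Fxf i : F a 4%N (comp (erefl 5%N : 3 + 2 = 5)%N x i f).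
  exact: (@F_comp a%N 0%N _ _ _ _ _ _ _ _ (addn0 _)).
have Ffx i : F a 4%N (comp (erefl 5%N : 2 + 3 = 5)%N f i x).
  exact: (@F_comp 0%N a%N _ _ _ _ _ _ _ _ (add0n _)).
have xfE i : symbol a (comp (erefl 5%N : 3 + 2 = 5)%N x i f) =
    c *: comp (erefl 5%N : 3 + 2 = 5)%N (symbol a x) i pr.
  by rewrite -compZr -fE (@symbol_comp a 0 _ _ _ _ _ _ _ _ (addn0 a)).
have fxE i : symbol a (comp (erefl 5%N : 2 + 3 = 5)%N f i x) =
    c *: comp (erefl 5%N : 2 + 3 = 5)%N pr i (symbol a x).
  by rewrite -compZl -fE (@symbol_comp 0 a _ _ _ _ _ _ _ _ (add0n a)).
have Fact (s : 'S_4) y : F a 4%N y -> F a 4%N (act s y) by apply: subseq_act.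
have FB3 : F a 4%N (x \o2_('i3_0) f - x \o2_('i3_1) f) by apply: subspaceB.
have FA3 : F a 4%N (act swap34 (f \o3_ord0 x)) by apply: Fact.
have FD3 := subspaceD FB3 FA3.
rewrite /leibniz_boundary symbolB // symbolD // symbolB // symbol_act //.
by rewrite !xfE !fxE actZ -scalerBr -scalerDr -scalerBr.
Qed.

Lemma leibnizator_eq0 : L = 0.
Proof.
apply: (power_eq0 fg_gen (a := 3)) => //; apply: symbol_eq0; first exact: leibnizator_power2.
have F1 := associator_power1; have F2 := leibnizator_power2.
apply: (leibniz_symbol_eq0 (y := symbol 1 A) (c := d) (d := c)) => //.
- exact: (symbol_arity3_form F2).
- exact: (symbol_arity3_form F1).
- by rewrite -symbol_act // leibnizator_swap.
rewrite -symbol_leibniz_boundary // -symbol_derivation_defect //.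
by rewrite derivation_defect_associator.
Qed.

Lemma associator_defect_eq0 a : F a 3%N A -> derivation_defect br (symbol a A) = 0.
Proof.
move=> FA; have /eqP := symbol_derivation_defect FA.
rewrite derivation_defect_associator -/L leibnizator_eq0 /leibniz_boundary.
rewrite !comp0l !comp0r [act _ 0]linear0 !subr0 addr0 symbol0 eq_sym.
by rewrite scaler_eq0 (negbTE d0) => /eqP.
Qed.

Lemma associator_eq0 : A = 0.
Proof.
apply: (power_eq0 fg_gen (a := 3)) => //.
have F1 := associator_power1.
have F2 : F 2%N 3%N A.
  apply: (symbol_eq0 F1); apply: product_symbol_eq0; first exact: (symbol_arity3_form F1).
  exact: associator_defect_eq0.
apply: (symbol_eq0 F2); apply: double_bracket_symbol_eq0; first exact: (symbol_arity3_form F2).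
exact: associator_defect_eq0.
Qed.

Lemma rigid_pair : ap_pair f g.
Proof.
split=> //; apply/eqP; rewrite -subr_eq0; apply/eqP.
  exact: associator_eq0.
exact: leibnizator_eq0.
Qed.

(** The homomorphism from the almost Poisson operad that sends the product and the
    bracket to [f] and [g]. *)
Let theta : operad_hom ap P := ap_hom rigid_pair.

Lemma theta_homogeneous a b n (x : ap n) :
  homogeneous pr br a b x -> homogeneous f g a b (theta n x).
Proof.
elim=> {a b n x}.
- rewrite hom_id; exact: homogeneous_id.
- rewrite ap_hom_prod; exact: homogeneous_left.
- rewrite ap_hom_bra; exact: homogeneous_right.
- by move=> a b a' b' l m n e x i y _ xh _ yh; rewrite hom_comp; apply: homogeneous_comp.
- by move=> a b n s x _ xh; rewrite hom_act; apply: homogeneous_act.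
- by move=> a b n abn; rewrite hom0; apply: homogeneous0.
- by move=> a b n e x y _ xh _ yh; rewrite homD homZ; apply: homogeneousZD.
Qed.

Lemma theta_power a b n (x : ap n) : homogeneous pr br a b x -> F a n (theta n x).
Proof. by move=> /theta_homogeneous/homogeneous_power. Qed.

Lemma symbol_theta a b n (x : ap n) : homogeneous pr br a b x ->
  symbol a (theta n x) = (c ^+ b * d ^+ a) *: x.
Proof.
elim=> {a b n x}.
- by rewrite hom_id symbol_id mulr1 scale1r.
- by rewrite ap_hom_prod fE mulr1.
- by rewrite ap_hom_bra gE mul1r.
- move=> a b a' b' l m n e x i y /theta_power Fx xE /theta_power Fy yE.
  rewrite hom_comp (symbol_comp e i erefl) // xE yE compZl compZr scalerA.
  by rewrite !exprD mulrACA.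
- by move=> a b n s x /theta_power Fx xE; rewrite hom_act symbol_act // xE actZ.
- by move=> a b n _; rewrite hom0 symbol0 scaler0.
- move=> a b n e x y /theta_power Fx xE /theta_power Fy yE.
  by rewrite homD homZ symbolP // xE yE scalerDr !scalerA mulrC.
Qed.

Lemma theta_injective n (x : ap n) : theta n x = 0 -> x = 0.
Proof.
have [y [yh ->]] := homogeneous_decomposition ap_gen x => y0.
rewrite big1 // => -[a an] _ /=.
(* The components of degree less than [a] vanish, so the image of the component of
   degree [a] is, up to sign, a sum of elements of [F^(a+1)]. *)
elim/ltn_ind: a an => a IH an.
have ya := yh a an.
apply/eqP; have := symbol_theta ya; rewrite symbol_filtS; last first.
  have -> : theta n (y a) = - \sum_(i < n | (a < i)%N) theta n (y i).
    apply/eqP; rewrite -addr_eq0 -[X in _ == X]y0 hom_sum [X in _ == X](bigD1 (Ordinal an)) //.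
    apply/eqP; congr (_ + _); rewrite big_mkcond [RHS]big_mkcond.
    apply: eq_bigr => i _; rewrite -val_eqE.
    have: (i < a)%N -> theta n (y i) = 0 by move=> ia; rewrite IH ?hom0.
    by move: (theta n (y i)) => t ti; case: ltngtP => //= /ti ->.
  apply: subspaceN; apply: subspace_sum => i ai.
  exact: filt_le ai (theta_power (yh i (ltn_ord i))).
move/esym/eqP; rewrite scaler_eq0 mulf_eq0 !expf_eq0 (negbTE c0) (negbTE d0).
by rewrite !andbF.
Qed.

Let image_space n : subspace (P n).
Proof.
exists (fun y => exists x, theta n x = y) => [|e _ _ [x <-] [y <-]].
  by exists 0; rewrite hom0.
by exists (e *: x + y); rewrite homD homZ.
Defined.

Let image_subseq : subseq P.
Proof. by exists image_space => n s _ [x <-]; exists (act s x); rewrite hom_act. Defined.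

Let image : suboperad P.
Proof.
exists image_subseq => [|l m n e _ i _ [x <-] [y <-]].
  by exists oid; rewrite hom_id.
by exists (comp e x i y); rewrite hom_comp.
Defined.

Lemma theta_surjective n (y : P n) : exists x, theta n x = y.
Proof.
apply: (fg_gen (S := image)).
  by exists pr; rewrite ap_hom_prod.
by exists br; rewrite ap_hom_bra.
Qed.

Lemma rigid_isomorphic : isomorphic P ap.
Proof. exact: hom_bijective_isomorphic theta_injective theta_surjective. Qed.

End Rigidity.

Theorem theorem4p1 (k : fieldType) (char0 : [pchar k] =i pred0)
    (P : operad k) (Pred : reduced P) (Pconn : connected P)
    (mu : P 2%N) (Pgen : generated_by mu) :
  isomorphic (gr (ideal_filtration (ideal_gen1 (mu - act swap12 mu))))
    (almost_poisson k) ->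
  isomorphic P (almost_poisson k).
Proof.
move=> [phi].
have char2 : 2%:R != 0 :> k.
  by have := char0 2%N; rewrite !inE /= => /negbT.
have swapK x : act swap12 (act swap12 x) = x :> P 2%N.
  by rewrite -actM tperm2 act1.
have fC : act swap12 (mu + act swap12 mu) = mu + act swap12 mu.
  by rewrite actD swapK addrC.
have gC : act swap12 (mu - act swap12 mu) = - (mu - act swap12 mu).
  by rewrite actB swapK opprB.
(* [mu] is half the sum of its polarizations. *)
have gen : generates (mu + act swap12 mu) (mu - act swap12 mu).
  move=> S Sf Sg; apply: Pgen.
  have -> : mu = 2%:R^-1 *: ((mu + act swap12 mu) + (mu - act swap12 mu)).
    by rewrite addrACA subrr addr0 -mulr2n -scaler_nat scalerA mulVf // scale1r.
  by apply: subspaceZ; apply: subspaceD.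
have [c fE] := symbol_prod char2 fC phi.
have [d gE] := symbol_bra char2 gC phi.
exact: rigid_isomorphic char2 gen fC gC phi c d fE gE.
Qed.
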